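(* Let $g_n\in\mathcal{A}$ for $n\in\mathbb{N}$, let $F\in\mathcal{A}$ be infinitely divisible, and let $k_1<k_2<\cdots$ be a sequence of positive integers. Let $\Phi$ be the generator of the composition semigroup $\{F_t\}_{t\ge 0}$ of $F$, i.e. the function with $\Phi(z)+z\in\mathcal{A}$ and $\frac{\partial F_t}{\partial t}=\Phi(F_t)$. Then $$\underbrace{g_n\circ g_n\circ\cdots\circ g_n}_{k_n}\to F$$ uniformly on compact subsets of $\mathbb{C}^+$ as $n\to\infty$ if and only if $$k_n\,(g_n(z)-z)\to\Phi(z)$$ uniformly on compact subsets of $\mathbb{C}^+$ as $n\to\infty$.
   Context: $\mathbb{C}^+=\{z\in\mathbb{C}:\Im z>0\}$. $\mathcal{A}$ is the set of analytic functions $F:\mathbb{C}^+\to\mathbb{C}^+$ with $\lim_{y\uparrow\infty}F(iy)/(iy)=1$; it is closed under composition. A function $F$ is called infinitely divisible if $F\in\mathcal{A}$ and for every $n\in\mathbb{N}$ there exists $g\in\mathcal{A}$ whose $n$-fold composition with itself equals $F$. Known facts used to define $\Phi$: $F\in\mathcal{A}$ is infinitely divisible if and only if there is a family $\{F_t:t\ge0\}\subset\mathcal{A}$ with $F_t\circ F_s=F_{t+s}$, $F_1=F$ (and $F_0(z)=z$), continuous in $t$ in the topology of uniform convergence on compact sets; each $F_t$ is then uniquely determined by $F$. For this family there exists a function $\Phi$ with $\Phi(z)+z\in\mathcal{A}$ such that $\frac{\partial F_t(z)}{\partial t}=\Phi(F_t(z))$ for all $z\in\mathbb{C}^+$, $t\ge0$.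 *)

(* Defs.v *)
From Stdlib Require Import Reals List.
From Coquelicot Require Import Coquelicot.

Open Scope R_scope.

(** Functions on the upper half-plane are represented by total functions
    [C -> C]; only their values at points [z] with [upper z] are ever
    constrained or used. *)
Definition upper (z : C) : Prop := 0 < Im z.

Definition analytic_upper (F : C -> C) : Prop :=
  forall z : C, upper z -> ex_derive (K := C_AbsRing) (V := C_NormedModule) F z.

Record classA (F : C -> C) : Prop := {
  classA_analytic : analytic_upper F;
  classA_upper : forall z : C, upper z -> upper (F z);
  classA_lim : filterlim (fun y : R => (F (Ci * RtoC y) / (Ci * RtoC y))%C)
                 (Rbar_locally p_infty) (locally (RtoC 1)) }.

(** Coquelicot and Stdlib only have compactness for subsets of [R]. *)
Definition compact_set {T : UniformSpace} (K : T -> Prop) : Prop :=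
  forall (I : Type) (U : I -> T -> Prop),
    (forall i : I, open (U i)) ->
    (forall x : T, K x -> exists i : I, U i x) ->
    exists l : list I, forall x : T, K x -> exists i : I, In i l /\ U i x.

(** The convergence is along an arbitrary filter [Flt], so as to cover both
    sequences ([eventually]) and continuity in a real parameter. *)
Definition cvg_compacts {T : Type} (Flt : (T -> Prop) -> Prop)
    (f : T -> C -> C) (h : C -> C) : Prop :=
  forall K : C -> Prop,
    compact_set K -> (forall z : C, K z -> upper z) ->
    forall eps : posreal,
      Flt (fun t => forall z : C, K z -> Cmod (f t z - h z)%C < eps).

Definition infinitely_divisible (F : C -> C) : Prop :=
  classA F /\
  forall n : nat, (1 <= n)%nat ->
    exists g : C -> C,
      classA g /\ forall z : C, upper z -> Nat.iter n g z = F z.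

(** [within (Rle 0) (locally t)] is the filter of neighbourhoods of [t] in
    the half-line [0 <= s]; it is one-sided at [t = 0]. *)
Record composition_semigroup (F : C -> C) (Ft : R -> C -> C) : Prop := {
  semigroup_classA : forall t : R, 0 <= t -> classA (Ft t);
  semigroup_comp : forall (t s : R) (z : C),
    0 <= t -> 0 <= s -> upper z -> Ft t (Ft s z) = Ft (t + s) z;
  semigroup_0 : forall z : C, upper z -> Ft 0 z = z;
  semigroup_1 : forall z : C, upper z -> Ft 1 z = F z;
  semigroup_continuous : forall t : R, 0 <= t ->
    cvg_compacts (within (Rle 0) (locally t)) Ft (Ft t) }.

(** [filterdiff] along [within (Rle 0) (locally t)] is [is_derive] with the
    time parameter restricted to [0 <= s]. *)
Record generator (Ft : R -> C -> C) (Phi : C -> C) : Prop := {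
  generator_classA : classA (fun z : C => (Phi z + z)%C);
  generator_derive : forall (z : C) (t : R), upper z -> 0 <= t ->
    filterdiff (K := R_AbsRing) (U := R_NormedModule) (V := C_R_NormedModule)
      (fun s : R => Ft s z) (within (Rle 0) (locally t))
      (fun h : R => scal h (Phi (Ft t z) : C_R_NormedModule)) }.

(* Main.v *)
(* The only tool from complex analysis is the inequality Im z * |f'(z)| <= Im f(z) for
   f analytic with Im f >= 0 on the half-plane, obtained from Goursat's theorem through the
   mean value property and a Cayley transform. It yields Harnack and Lipschitz bounds with
   constants depending only on Im f at one point, and Im F(z) >= Im z for F in class A.

   If k_n (g_n - id) -> Phi, then iterating g_n is the Euler scheme of w' = Phi(w). The
   local error is o(1/k_n) uniformly along the flow, and iterates of g_n, being
   Schwarz-Pick contractions, do not amplify it.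

   Conversely let h_n = g_n^(k_n) -> F and Phi_n = k_n (g_n - id), so Im Phi_n >= 0. At a
   point w with Im F(w) <= (1 + eps) Im w, the steps g_n - id stay nearly constant along
   the orbit of w, hence h_n(w) - w = Phi_n(w) (1 + O(eps)). Applied also to the roots
   F_(1/n) of F this gives F(w) - w = Phi(w) (1 + O(eps)), so Phi_n(w) and Phi(w) are close
   up to a factor 1 + O(eps). Such points occur on every F-orbit. Since g_n commutes with
   h_n, Phi_n(F(z)) - F'(z) Phi_n(z) -> 0, while Phi(F(z)) = F'(z) Phi(z); transporting the
   comparison back along the orbit gives Phi_n(z) -> Phi(z) at every z, and the Lipschitz
   bounds make the convergence locally uniform. *)

Require Import Defs.
From Stdlib Require Import Reals Lra Lia List ClassicalEpsilon FunctionalExtensionality.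
From Coquelicot Require Import Coquelicot.

(** * Goursat's theorem on rectangles *)

(** The obstacle in the converse is that nothing bounds Phi_n beforehand, and normal families would
    only give subsequential limits still to be identified. The inequality Im z |f'(z)| <= Im f(z)
    plays the part of Montel's theorem: Phi_n, Phi and all iterates have nonnegative imaginary part,
    so a bound at one point spreads to every compact set. A point of small gain supplies that bound,
    because there Phi_n is comparable to the convergent h_n - id. The comparison at such points is
    relative, and this is what survives transport. The number m of orbit steps depends on eps, so
    the derivative l of the m-th iterate of F may be very small, but an error eps |Phi(F^m(z))| =
    eps |l| |Phi(z)| loses the factor |l| on the way back. The absolute errors vanish as n grows
    with m fixed. Dividing by l is safe when Phi has no zero; a single zero forces Phi = 0 and F =
    id, a case treated apart. *)

Lemma choice_fun {A B : Type} (Q : A -> B -> Prop) :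
  (forall x, exists y, Q x y) -> exists f : A -> B, forall x, Q x (f x).
Proof.
  intro H. exists (fun x => proj1_sig (constructive_indefinite_description _ (H x))).
  intro x. exact (proj2_sig (constructive_indefinite_description _ (H x))).
Qed.

(** Nested bisection: a box failing [P] has a quarter failing [P], and such quarters shrink to a
    point where the local hypothesis gives a contradiction. It serves both Goursat's estimate and
    the compactness of rectangles. *)
Lemma box_induction (P : R -> R -> R -> R -> Prop) (a b c d : R) :
  a <= b -> c <= d ->
  (forall a1 b1 c1 d1, a <= a1 -> a1 <= b1 -> b1 <= b ->
     c <= c1 -> c1 <= d1 -> d1 <= d ->
     let m := (a1 + b1) / 2 in let n := (c1 + d1) / 2 in
     P a1 m c1 n -> P a1 m n d1 -> P m b1 c1 n -> P m b1 n d1 ->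
     P a1 b1 c1 d1) ->
  (forall x y, a <= x <= b -> c <= y <= d ->
     exists delta, 0 < delta /\
       forall a1 b1 c1 d1, a <= a1 <= x -> x <= b1 <= b ->
         c <= c1 <= y -> y <= d1 <= d ->
         b1 - a1 < delta -> d1 - c1 < delta -> P a1 b1 c1 d1) ->
  P a b c d.
Proof.
  intros Hab Hcd Hsplit Hloc.
  destruct (classic (P a b c d)) as [|HnP]; [assumption|exfalso].
  set (inside := fun t : (R * R) * (R * R) =>
    a <= fst (fst t) /\ fst (fst t) <= snd (fst t) /\ snd (fst t) <= b /\
    c <= fst (snd t) /\ fst (snd t) <= snd (snd t) /\ snd (snd t) <= d).
  set (bad := fun t : (R * R) * (R * R) => inside t /\
    ~ P (fst (fst t)) (snd (fst t)) (fst (snd t)) (snd (snd t))).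
  assert (Hstep : forall t, exists t', bad t ->
    bad t' /\ fst (fst t) <= fst (fst t') /\ snd (fst t') <= snd (fst t) /\
    fst (snd t) <= fst (snd t') /\ snd (snd t') <= snd (snd t) /\
    snd (fst t') - fst (fst t') = (snd (fst t) - fst (fst t)) / 2 /\
    snd (snd t') - fst (snd t') = (snd (snd t) - fst (snd t)) / 2).
  { intros [[a1 b1] [c1 d1]].
    (* The bisection map has to be total, so a box that is not bad is sent to an arbitrary value. *)
    destruct (classic (bad ((a1, b1), (c1, d1)))) as [[Hin Hbad]|Hb];
      [|exists ((0, 0), (0, 0)); tauto].
    unfold inside in Hin; cbn in Hin, Hbad.
    destruct Hin as (h1 & h2 & h3 & h4 & h5 & h6).
    assert (HH := Hsplit a1 b1 c1 d1 h1 h2 h3 h4 h5 h6). cbn in HH.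
    set (m := (a1 + b1) / 2) in *. set (n := (c1 + d1) / 2) in *.
    assert (Hm : m = (a1 + b1) / 2) by reflexivity.
    assert (Hn : n = (c1 + d1) / 2) by reflexivity.
    destruct (classic (P a1 m c1 n)) as [q1|q1];
      [destruct (classic (P a1 m n d1)) as [q2|q2];
        [destruct (classic (P m b1 c1 n)) as [q3|q3];
          [destruct (classic (P m b1 n d1)) as [q4|q4]; [tauto|]|]|]|].
    - exists ((m, b1), (n, d1)); intros _; unfold bad, inside; cbn.
      repeat split; try assumption; lra.
    - exists ((m, b1), (c1, n)); intros _; unfold bad, inside; cbn.
      repeat split; try assumption; lra.
    - exists ((a1, m), (n, d1)); intros _; unfold bad, inside; cbn.
      repeat split; try assumption; lra.
    - exists ((a1, m), (c1, n)); intros _; unfold bad, inside; cbn.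
      repeat split; try assumption; lra. }
  destruct (choice_fun _ Hstep) as [f Hf].
  set (u := fun n => Nat.iter n f ((a, b), (c, d))).
  assert (Hu : forall n, bad (u n)).
  { induction n as [|n IH].
    - split; [unfold inside; cbn; lra|exact HnP].
    - exact (proj1 (Hf _ IH)). }
  assert (HuS : forall n, fst (fst (u n)) <= fst (fst (u (S n))) /\
    snd (fst (u (S n))) <= snd (fst (u n)) /\
    fst (snd (u n)) <= fst (snd (u (S n))) /\
    snd (snd (u (S n))) <= snd (snd (u n)) /\
    snd (fst (u (S n))) - fst (fst (u (S n))) =
      (snd (fst (u n)) - fst (fst (u n))) / 2 /\
    snd (snd (u (S n))) - fst (snd (u (S n))) =
      (snd (snd (u n)) - fst (snd (u n))) / 2).
  { intro n. exact (proj2 (Hf _ (Hu n))). }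
  assert (Hnest : forall n m : nat, fst (fst (u n)) <= fst (fst (u (n + m)%nat)) /\
    snd (fst (u (n + m)%nat)) <= snd (fst (u n)) /\
    fst (snd (u n)) <= fst (snd (u (n + m)%nat)) /\
    snd (snd (u (n + m)%nat)) <= snd (snd (u n))).
  { intros n m; induction m as [|m IH]; [rewrite Nat.add_0_r; lra|].
    rewrite Nat.add_succ_r. specialize (HuS (n + m)%nat). lra. }
  assert (Hin : forall n, inside (u n)) by (intro n; apply Hu).
  assert (Hx : exists x, forall n, fst (fst (u n)) <= x <= snd (fst (u n))).
  { destruct (completeness (fun r => exists n, r = fst (fst (u n)))) as [x [Hub Hlub]].
    - exists b. intros r [n ->]. destruct (Hin n); lra.
    - exists (fst (fst (u O))); now exists O.
    - exists x; intro n; split; [apply Hub; now exists n|].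
      apply Hlub; intros r [m ->].
      destruct (Hnest n m) as (_ & k2 & _). destruct (Hnest m n) as (k1 & _).
      rewrite (Nat.add_comm m n) in k1.
      destruct (Hin (n + m)%nat); lra. }
  assert (Hy : exists y, forall n, fst (snd (u n)) <= y <= snd (snd (u n))).
  { destruct (completeness (fun r => exists n, r = fst (snd (u n)))) as [x [Hub Hlub]].
    - exists d. intros r [n ->]. destruct (Hin n); lra.
    - exists (fst (snd (u O))); now exists O.
    - exists x; intro n; split; [apply Hub; now exists n|].
      apply Hlub; intros r [m ->].
      destruct (Hnest n m) as (_ & _ & _ & k2). destruct (Hnest m n) as (_ & _ & k1 & _).
      rewrite (Nat.add_comm m n) in k1.
      destruct (Hin (n + m)%nat); lra. }
  destruct Hx as [x Hx], Hy as [y Hy].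
  destruct (Hloc x y) as (delta & Hd & Hsmall).
  { exact (Hx O). } { exact (Hy O). }
  assert (Hw : forall n, snd (fst (u n)) - fst (fst (u n)) = (b - a) * (/ 2) ^ n /\
     snd (snd (u n)) - fst (snd (u n)) = (d - c) * (/ 2) ^ n).
  { induction n as [|n IH]; [cbn; lra|]. specialize (HuS n). cbn [pow]. lra. }
  assert (Hq : Rabs (/ 2) < 1) by (rewrite Rabs_pos_eq; lra).
  assert (Hq' : 0 < delta / (1 + (b - a) + (d - c))) by (apply Rdiv_lt_0_compat; lra).
  destruct (pow_lt_1_zero (/ 2) Hq _ Hq') as [N HN].
  specialize (HN N (le_n N)).
  assert (Hp : 0 < (/ 2) ^ N) by (apply pow_lt; lra).
  rewrite Rabs_pos_eq in HN by lra.
  apply (Rmult_lt_compat_r (1 + (b - a) + (d - c))) in HN; [|lra].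
  unfold Rdiv in HN. rewrite Rmult_assoc, Rinv_l, Rmult_1_r in HN by lra.
  destruct (Hu N) as [(i1 & i2 & i3 & i4 & i5 & i6) HnPN]. apply HnPN.
  specialize (Hx N); specialize (Hy N); destruct (Hw N) as [w1 w2].
  apply Hsmall; nra.
Qed.

(** The imaginary part of the counterclockwise boundary integral of u + i v. *)
Definition box_circulation (u v : R -> R -> R) (a b c d : R) : R :=
  RInt (fun s => v s c - v s d) a b + RInt (fun t => u b t - u a t) c d.

Lemma differentiable_pt_lim_continuous_l (u : R -> R -> R) (x y l1 l2 : R) :
  differentiable_pt_lim u x y l1 l2 -> continuous (fun s => u s y) x.
Proof.
  intro H.
  assert (H1 : continuity_2d_pt u x y).
  { apply differentiable_continuity_pt. now exists l1, l2. }
  apply continuity_pt_filterlim. intros eps Heps.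
  destruct (H1 (mkposreal eps Heps)) as [del Hd].
  exists del; split; [apply cond_pos|]. intros x' [_ Hx'].
  apply Hd; [exact Hx'|]. rewrite Rminus_diag, Rabs_R0. apply cond_pos.
Qed.

Lemma differentiable_pt_lim_continuous_r (u : R -> R -> R) (x y l1 l2 : R) :
  differentiable_pt_lim u x y l1 l2 -> continuous (fun t => u x t) y.
Proof.
  intro H.
  assert (H1 : continuity_2d_pt u x y).
  { apply differentiable_continuity_pt. now exists l1, l2. }
  apply continuity_pt_filterlim. intros eps Heps.
  destruct (H1 (mkposreal eps Heps)) as [del Hd].
  exists del; split; [apply cond_pos|]. intros x' [_ Hx'].
  apply Hd; [|exact Hx']. rewrite Rminus_diag, Rabs_R0. apply cond_pos.
Qed.

(* Goursat's bisection; [u + i v] is holomorphic in [s + i t]. *)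
Lemma goursat_box (u v : R -> R -> R) (a b c d : R) :
  a <= b -> c <= d ->
  (forall x y, a <= x <= b -> c <= y <= d -> exists A B,
     differentiable_pt_lim u x y A (- B) /\ differentiable_pt_lim v x y B A) ->
  box_circulation u v a b c d = 0.
Proof.
  intros Hab Hcd Hdiff.
  assert (cul : forall x y, a <= x <= b -> c <= y <= d -> continuous (fun s => v s y) x).
  { intros x y Hx Hy. destruct (Hdiff x y Hx Hy) as (A & B & _ & Hv).
    eapply differentiable_pt_lim_continuous_l, Hv. }
  assert (cur : forall x y, a <= x <= b -> c <= y <= d -> continuous (fun t => u x t) y).
  { intros x y Hx Hy. destruct (Hdiff x y Hx Hy) as (A & B & Hu & _).
    eapply differentiable_pt_lim_continuous_r, Hu. }
  assert (iv : forall a1 b1 c1 d1, a <= a1 -> a1 <= b1 -> b1 <= b ->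
     c <= c1 <= d -> c <= d1 <= d -> ex_RInt (fun s => v s c1 - v s d1) a1 b1).
  { intros. apply (ex_RInt_continuous (V := R_CompleteNormedModule)). intros z Hz.
    rewrite Rmin_left, Rmax_right in Hz by lra.
    apply (continuous_minus (V := R_NormedModule)); apply cul; lra. }
  assert (iu : forall a1 b1 c1 d1, a <= a1 <= b -> a <= b1 <= b ->
     c <= c1 -> c1 <= d1 -> d1 <= d -> ex_RInt (fun t => u b1 t - u a1 t) c1 d1).
  { intros. apply (ex_RInt_continuous (V := R_CompleteNormedModule)). intros z Hz.
    rewrite Rmin_left, Rmax_right in Hz by lra.
    apply (continuous_minus (V := R_NormedModule)); apply cur; lra. }
  (* The squared half-perimeter is exactly additive under quartering, so the bound on a box follows
     from the bounds on its quarters. *)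
  assert (Hsmall : forall eps, 0 < eps ->
    Rabs (box_circulation u v a b c d) <= eps * (((b - a) + (d - c)) ^ 2)).
  { intros eps Heps.
    apply (box_induction (fun a1 b1 c1 d1 =>
      Rabs (box_circulation u v a1 b1 c1 d1) <= eps * (((b1 - a1) + (d1 - c1)) ^ 2)));
      [assumption..| |].
    - intros a1 b1 c1 d1 h1 h2 h3 h4 h5 h6 m n P1 P2 P3 P4.
      assert (Hm : m = (a1 + b1) / 2) by reflexivity.
      assert (Hn : n = (c1 + d1) / 2) by reflexivity.
      clearbody m n.
      assert (E : box_circulation u v a1 b1 c1 d1 =
        box_circulation u v a1 m c1 n + box_circulation u v a1 m n d1 +
        box_circulation u v m b1 c1 n + box_circulation u v m b1 n d1).
      { unfold box_circulation.
        rewrite <- (RInt_Chasles (fun s => v s c1 - v s d1) a1 m b1) by (apply iv; lra).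
        rewrite <- (RInt_Chasles (fun t => u b1 t - u a1 t) c1 n d1) by (apply iu; lra).
        assert (V : forall p q, a <= p -> p <= q -> q <= b ->
          RInt (fun s => v s c1 - v s d1) p q =
          RInt (fun s => v s c1 - v s n) p q + RInt (fun s => v s n - v s d1) p q).
        { intros. rewrite <- (RInt_plus (V := R_CompleteNormedModule)) by (apply iv; lra).
          apply RInt_ext; intros; unfold plus; simpl; ring. }
        assert (W : forall p q, c <= p -> p <= q -> q <= d ->
          RInt (fun t => u b1 t - u a1 t) p q =
          RInt (fun t => u b1 t - u m t) p q + RInt (fun t => u m t - u a1 t) p q).
        { intros. rewrite <- (RInt_plus (V := R_CompleteNormedModule)) by (apply iu; lra).
          apply RInt_ext; intros; unfold plus; simpl; ring. }
        rewrite !V, !W by lra. unfold plus; simpl. ring. }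
      rewrite E.
      replace ((b1 - a1 + (d1 - c1)) ^ 2) with
        (((m - a1) + (n - c1)) ^ 2 + ((m - a1) + (d1 - n)) ^ 2 +
         ((b1 - m) + (n - c1)) ^ 2 + ((b1 - m) + (d1 - n)) ^ 2)
        by (rewrite Hm, Hn; field).
      eapply Rle_trans; [apply Rabs_triang|].
      eapply Rle_trans; [apply Rplus_le_compat_r, Rabs_triang|].
      eapply Rle_trans; [apply Rplus_le_compat_r, Rplus_le_compat_r, Rabs_triang|].
      lra.
    - intros x y Hx Hy.
      destruct (Hdiff x y Hx Hy) as (A & B & Du & Dv).
      assert (He : 0 < eps / 4) by lra.
      destruct (Du (mkposreal _ He)) as [d1 H1].
      destruct (Dv (mkposreal _ He)) as [d2 H2].
      exists (Rmin d1 d2). split; [apply Rmin_pos; apply cond_pos|].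
      intros a1 b1 c1 e1 Ha1 Hb1 Hc1 He1 w1 w2. simpl in H1, H2.
      set (D := (b1 - a1) + (e1 - c1)).
      assert (Hmin1 := Rmin_l d1 d2). assert (Hmin2 := Rmin_r d1 d2).
      assert (HU : forall s t, a1 <= s <= b1 -> c1 <= t <= e1 ->
        Rabs (u s t - u x y - (A * (s - x) + - B * (t - y))) <= eps / 4 * D).
      { intros s t Hs Ht. eapply Rle_trans; [apply H1; apply Rabs_def1; lra|].
        apply Rmult_le_compat_l; [lra|]. unfold D. apply Rmax_lub; apply Rabs_le; lra. }
      assert (HV : forall s t, a1 <= s <= b1 -> c1 <= t <= e1 ->
        Rabs (v s t - v x y - (B * (s - x) + A * (t - y))) <= eps / 4 * D).
      { intros s t Hs Ht. eapply Rle_trans; [apply H2; apply Rabs_def1; lra|].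
        apply Rmult_le_compat_l; [lra|]. unfold D. apply Rmax_lub; apply Rabs_le; lra. }
      (* By the Cauchy-Riemann equations the linear parts contribute -A and +A times the area. They
         cancel, and only the remainders are integrated. *)
      assert (E : box_circulation u v a1 b1 c1 e1 =
        RInt (fun s => v s c1 - v s e1 + A * (e1 - c1)) a1 b1 +
        RInt (fun t => u b1 t - u a1 t - A * (b1 - a1)) c1 e1).
      { unfold box_circulation.
        rewrite (RInt_plus (V := R_CompleteNormedModule) (fun s => v s c1 - v s e1)
           (fun _ => A * (e1 - c1))) by (try apply ex_RInt_const; apply iv; lra).
        rewrite (RInt_minus (V := R_CompleteNormedModule) (fun t => u b1 t - u a1 t)
           (fun _ => A * (b1 - a1))) by (try apply ex_RInt_const; apply iu; lra).
        rewrite !RInt_const. unfold plus, minus, opp, scal; simpl; unfold mult; simpl.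
        unfold plus, opp; simpl. ring. }
      rewrite E.
      eapply Rle_trans; [apply Rabs_triang|].
      replace (eps * D ^ 2) with
        ((b1 - a1) * (eps / 4 * D + eps / 4 * D) +
         (e1 - c1) * (eps / 4 * D + eps / 4 * D) + eps / 2 * D ^ 2)
        by (unfold D; field).
      assert (0 <= eps / 2 * D ^ 2) by (apply Rmult_le_pos; [lra|apply pow2_ge_0]).
      enough (Rabs (RInt (fun s => v s c1 - v s e1 + A * (e1 - c1)) a1 b1) <=
                (b1 - a1) * (eps / 4 * D + eps / 4 * D) /\
              Rabs (RInt (fun t => u b1 t - u a1 t - A * (b1 - a1)) c1 e1) <=
                (e1 - c1) * (eps / 4 * D + eps / 4 * D)) by lra.
      split; apply abs_RInt_le_const; try lra.
      + apply (ex_RInt_plus (V := R_NormedModule)); [apply iv; lra|apply ex_RInt_const].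
      + intros s Hs.
        assert (K1 := HV s c1 Hs ltac:(lra)). assert (K2 := HV s e1 Hs ltac:(lra)).
        apply Rabs_le_between in K1, K2. apply Rabs_le; lra.
      + apply (ex_RInt_minus (V := R_NormedModule)); [apply iu; lra|apply ex_RInt_const].
      + intros t Ht.
        assert (K1 := HU b1 t ltac:(lra) Ht). assert (K2 := HU a1 t ltac:(lra) Ht).
        apply Rabs_le_between in K1, K2. apply Rabs_le; lra. }
  destruct (Req_dec (box_circulation u v a b c d) 0) as [|Hne]; [assumption|exfalso].
  set (X := Rabs (box_circulation u v a b c d)) in *.
  assert (HX : 0 < X) by now apply Rabs_pos_lt.
  set (Q := ((b - a) + (d - c)) ^ 2) in *.
  assert (HQ : 0 <= Q) by apply pow2_ge_0.
  specialize (Hsmall (X / (2 * (Q + 1)))).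
  assert (0 < X / (2 * (Q + 1))) by (apply Rdiv_lt_0_compat; lra).
  specialize (Hsmall H).
  assert (X / (2 * (Q + 1)) * (Q + 1) = X / 2) by (field; lra).
  nra.
Qed.

(** * Complex derivatives and the mean value property *)

(** Stated with [Cmod] and explicit radii because all later estimates are; the calculus rules are
    imported through [is_derive_cderiv]. *)
Definition cderiv (f : C -> C) (z d : C) : Prop :=
  forall eps : R, 0 < eps -> exists delta : R, 0 < delta /\
    forall w : C, Cmod (w - z) < delta ->
      Cmod (f w - f z - d * (w - z)) <= eps * Cmod (w - z).

Definition ccont (f : C -> C) (z : C) : Prop :=
  forall eps : R, 0 < eps -> exists delta : R, 0 < delta /\
    forall w : C, Cmod (w - z) < delta -> Cmod (f w - f z) < eps.

Lemma is_derive_cderiv (f : C -> C) (z d : C) :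
  is_derive (K := C_AbsRing) (V := AbsRing_NormedModule C_AbsRing) f z d <->
  cderiv f z d.
Proof.
  split.
  - intros [_ H] eps Heps.
    destruct (H z (fun P HP => HP) (mkposreal eps Heps)) as [del Hd].
    exists del; split; [apply cond_pos|]. intros w Hw.
    specialize (Hd w Hw). unfold norm, minus, plus, opp, scal, mult in Hd; simpl in Hd.
    unfold abs, scal, mult in Hd; simpl in Hd.
    replace (f w - f z - d * (w - z))%C with (f w + - f z + - ((w + - z) * d))%C by ring.
    exact Hd.
  - intros H. split; [apply is_linear_scal_l|].
    intros x Hx eps. rewrite <- (is_filter_lim_locally_unique (V := AbsRing_NormedModule C_AbsRing) z x Hx).
    destruct (H eps (cond_pos eps)) as (del & Hd & Hw).
    exists (mkposreal del Hd). intros w HB.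
    specialize (Hw w HB). unfold norm, minus, plus, opp, scal, mult; simpl.
    unfold abs, mult; simpl.
    replace (f w + - f z + - ((w + - z) * d))%C with (f w - f z - d * (w - z))%C by ring.
    exact Hw.
Qed.

Lemma ex_derive_cderiv (f : C -> C) (z : C) :
  ex_derive (K := C_AbsRing) (V := C_NormedModule) f z -> exists d, cderiv f z d.
Proof.
  intros [d [_ H]]. exists d. intros eps Heps.
  destruct (H z (fun P HP => HP) (mkposreal eps Heps)) as [del Hd].
  exists del; split; [apply cond_pos|]. intros w Hw.
  specialize (Hd w Hw).
  replace (f w - f z - d * (w - z))%C with (f w + - f z + - ((w + - z) * d))%C by ring.
  exact Hd.
Qed.

Lemma cderiv_const (c z : C) : cderiv (fun _ => c) z 0.
Proof. apply is_derive_cderiv. exact (is_derive_const (V := AbsRing_NormedModule C_AbsRing) c z). Qed.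

Lemma cderiv_id (z : C) : cderiv (fun w => w) z 1.
Proof. apply is_derive_cderiv. exact (is_derive_id z). Qed.

Lemma cderiv_plus (f g : C -> C) (z df dg : C) :
  cderiv f z df -> cderiv g z dg -> cderiv (fun w => f w + g w)%C z (df + dg)%C.
Proof.
  rewrite <- !is_derive_cderiv. intros Hf Hg.
  exact (is_derive_plus (V := AbsRing_NormedModule C_AbsRing) f g z df dg Hf Hg).
Qed.

Lemma cderiv_minus (f g : C -> C) (z df dg : C) :
  cderiv f z df -> cderiv g z dg -> cderiv (fun w => f w - g w)%C z (df - dg)%C.
Proof.
  rewrite <- !is_derive_cderiv. intros Hf Hg.
  exact (is_derive_minus (V := AbsRing_NormedModule C_AbsRing) f g z df dg Hf Hg).
Qed.

Lemma cderiv_mult (f g : C -> C) (z df dg : C) :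
  cderiv f z df -> cderiv g z dg ->
  cderiv (fun w => f w * g w)%C z (df * g z + f z * dg)%C.
Proof.
  rewrite <- !is_derive_cderiv. intros Hf Hg.
  exact (is_derive_mult (K := C_AbsRing) f g z df dg Hf Hg Cmult_comm).
Qed.

Lemma cderiv_eq (f : C -> C) (z d d' : C) : cderiv f z d -> d = d' -> cderiv f z d'.
Proof. now intros H <-. Qed.

Lemma cderiv_scal (c : C) (f : C -> C) (z d : C) :
  cderiv f z d -> cderiv (fun w => c * f w)%C z (c * d)%C.
Proof.
  intro H. eapply cderiv_eq; [exact (cderiv_mult _ _ _ _ _ (cderiv_const c z) H)|cbv beta; ring].
Qed.

Lemma cderiv_affine (a b z : C) : cderiv (fun w => a + b * w)%C z b.
Proof.
  eapply cderiv_eq;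
    [exact (cderiv_plus _ _ _ _ _ (cderiv_const a z) (cderiv_scal b _ _ _ (cderiv_id z)))|cbv beta; ring].
Qed.

Lemma cderiv_comp (f g : C -> C) (z df dg : C) :
  cderiv f (g z) df -> cderiv g z dg -> cderiv (fun w => f (g w)) z (df * dg)%C.
Proof.
  rewrite <- !is_derive_cderiv. intros Hf Hg.
  rewrite (Cmult_comm df dg).
  exact (is_derive_comp (V := AbsRing_NormedModule C_AbsRing) f g z df dg Hf Hg).
Qed.

Lemma RtoC_neq (x y : R) : x <> y -> RtoC x <> RtoC y.
Proof. intros H E. now apply H, RtoC_inj. Qed.

Lemma Cmod_minus_sym (z w : C) : Cmod (z - w) = Cmod (w - z).
Proof. rewrite <- Cmod_opp. f_equal; ring. Qed.

Lemma Cmod_triangle_minus (x y : C) : Cmod (x - y) <= Cmod x + Cmod y.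
Proof. rewrite <- (Cmod_opp y). apply Cmod_triangle. Qed.

Lemma Cmod_triangle_inv (x y : C) : Cmod x <= Cmod y + Cmod (x - y).
Proof. replace x with (y + (x - y))%C at 1 by ring. apply Cmod_triangle. Qed.

Lemma im_le_Cmod (c : C) : Rabs (Im c) <= Cmod c.
Proof.
  eapply Rle_trans; [|apply Rmax_Cmod]. apply Rmax_r.
Qed.

Lemma Cmod_le_re_im (c : C) : Cmod c <= Rabs (Re c) + Rabs (Im c).
Proof.
  replace c with (RtoC (Re c) + RtoC (Im c) * Ci)%C at 1
    by (destruct c; unfold Cplus, Cmult, RtoC, Ci, Re, Im; simpl; f_equal; ring).
  eapply Rle_trans; [apply Cmod_triangle|].
  rewrite Cmod_mult, Cmod_Ci, !Cmod_R. lra.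
Qed.

Lemma cderiv_cont (f : C -> C) (z d : C) : cderiv f z d -> ccont f z.
Proof.
  intros H eps Heps. destruct (H 1 Rlt_0_1) as (del & Hd & Hw).
  assert (HM : 0 < eps / (1 + Cmod d)).
  { apply Rdiv_lt_0_compat; [assumption|]. assert (h := Cmod_ge_0 d); lra. }
  exists (Rmin del (eps / (1 + Cmod d))). split; [now apply Rmin_pos|].
  intros w Hlt.
  assert (H1 := Rmin_l del (eps / (1 + Cmod d))).
  assert (H2 := Rmin_r del (eps / (1 + Cmod d))).
  specialize (Hw w ltac:(lra)).
  assert (H3 := Cmod_triangle_inv (f w - f z) (d * (w - z))).
  rewrite Cmod_mult in H3.
  assert (Hl : Cmod (w - z) < eps / (1 + Cmod d)) by lra.
  apply (Rmult_lt_compat_r (1 + Cmod d)) in Hl;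
    [|assert (h := Cmod_ge_0 d); lra].
  unfold Rdiv in Hl. rewrite Rmult_assoc, Rinv_l in Hl;
    [lra|assert (h := Cmod_ge_0 d); lra].
Qed.

Lemma cderiv_inv (z : C) : z <> 0 -> cderiv (fun w => / w)%C z (- / (z * z))%C.
Proof.
  intros Hz eps Heps.
  assert (Hm : 0 < Cmod z) by now apply Cmod_gt_0.
  (* The remainder is (w - z)^2 / (w z^2), and |w| > |z| / 2 makes it at most 2 |w - z|^2 /
     |z|^3. *)
  exists (Rmin (Cmod z / 2) (eps * Cmod z ^ 3 / 2)).
  assert (Hp : 0 < eps * Cmod z ^ 3 / 2).
  { apply Rdiv_lt_0_compat; [|lra]. apply Rmult_lt_0_compat; [lra|].
    now apply pow_lt. }
  split; [apply Rmin_pos; lra|]. intros w Hw.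
  assert (H1 := Rmin_l (Cmod z / 2) (eps * Cmod z ^ 3 / 2)).
  assert (H2 := Rmin_r (Cmod z / 2) (eps * Cmod z ^ 3 / 2)).
  assert (Hw1 : Cmod z / 2 < Cmod w).
  { assert (H3 := Cmod_triangle_inv z w). rewrite Cmod_minus_sym in H3. lra. }
  assert (Hw0 : w <> 0) by (apply Cmod_gt_0; lra).
  replace (/ w - / z - - / (z * z) * (w - z))%C with
    ((w - z) * ((w - z) / (w * z * z)))%C by (field; auto).
  rewrite Cmod_mult, Rmult_comm. apply Rmult_le_compat_r; [apply Cmod_ge_0|].
  rewrite Cmod_div, !Cmod_mult by (repeat apply Cmult_neq_0; assumption).
  assert (0 < Cmod w * Cmod z * Cmod z) by (repeat apply Rmult_lt_0_compat; lra).
  apply Rle_div_l; [lra|].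
  apply Rle_trans with (eps * Cmod z ^ 3 / 2); [lra|].
  assert (0 <= (Cmod w - Cmod z / 2) * (eps * Cmod z * Cmod z)).
  { apply Rmult_le_pos; [lra|]. apply Rmult_le_pos; [|lra].
    apply Rmult_le_pos; lra. }
  nra.
Qed.

Lemma cderiv_differentiable_re (f : C -> C) (x y : R) (d : C) :
  cderiv f (x, y) d -> differentiable_pt_lim (fun s t => Re (f (s, t))) x y (Re d) (- Im d).
Proof.
  intros H eps.
  assert (He : 0 < eps / 2) by (assert (h := cond_pos eps); lra).
  destruct (H _ He) as (del & Hd & Hw).
  assert (Hd2 : 0 < del / 2) by lra.
  exists (mkposreal _ Hd2). intros s t Hs Ht. simpl in Hs, Ht.
  assert (Hn : Cmod ((s, t) - (x, y))%C <= Rabs (s - x) + Rabs (t - y)).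
  { eapply Rle_trans; [apply Cmod_le_re_im|]. apply Req_le; reflexivity. }
  specialize (Hw (s, t) ltac:(lra)).
  eapply Rle_trans; [|eapply Rle_trans; [exact Hw|]].
  - eapply Rle_trans; [|apply re_le_Cmod]. apply Req_le. f_equal.
    unfold Re, Im; simpl. ring.
  - eapply Rle_trans; [apply Rmult_le_compat_l; [lra|exact Hn]|].
    assert (h1 := Rmax_l (Rabs (s - x)) (Rabs (t - y))).
    assert (h2 := Rmax_r (Rabs (s - x)) (Rabs (t - y))).
    nra.
Qed.

Lemma cderiv_differentiable_im (f : C -> C) (x y : R) (d : C) :
  cderiv f (x, y) d -> differentiable_pt_lim (fun s t => Im (f (s, t))) x y (Im d) (Re d).
Proof.
  intros H.
  assert (H1 := cderiv_scal (- Ci)%C f _ _ H).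
  apply cderiv_differentiable_re in H1.
  replace (Im d) with (Re (- Ci * d)%C) by (unfold Re, Im; simpl; ring).
  replace (Re d) with (- Im (- Ci * d)%C) by (unfold Re, Im; simpl; ring).
  intros eps. destruct (H1 eps) as [del Hd]. exists del. intros u v Hu Hv.
  specialize (Hd u v Hu Hv).
  replace (Im (f (u, v))) with (Re (- Ci * f (u, v))%C) by (unfold Re, Im; simpl; ring).
  replace (Im (f (x, y))) with (Re (- Ci * f (x, y))%C) by (unfold Re, Im; simpl; ring).
  exact Hd.
Qed.

(* The substitution [w = e^(s + i t)] turns circles into segments. *)
Definition polar (s t : R) : C := (exp s * cos t, exp s * sin t).

Lemma Cmod_polar (s t : R) : Cmod (polar s t) = exp s.
Proof.
  unfold polar, Cmod. simpl.
  replace (exp s * cos t * (exp s * cos t * 1) + exp s * sin t * (exp s * sin t * 1))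
    with (exp s * exp s * (Rsqr (sin t) + Rsqr (cos t))) by (unfold Rsqr; ring).
  rewrite sin2_cos2, Rmult_1_r. apply sqrt_square. left; apply exp_pos.
Qed.

Lemma differentiable_pt_lim_exp_mult (f : R -> R) (f' : R) (s t : R) :
  is_derive f t f' ->
  differentiable_pt_lim (fun a b => exp a * f b) s t (exp s * f t) (exp s * f').
Proof.
  intros Hf.
  assert (H1 : differentiable_pt_lim Rmult (exp s) (f t) (f t) (exp s)).
  { intros eps. exists eps. intros u v Hu Hv.
    replace (u * v - exp s * f t - (f t * (u - exp s) + exp s * (v - f t)))
      with ((u - exp s) * (v - f t)) by ring.
    rewrite Rabs_mult. apply Rmult_le_compat; try apply Rabs_pos; [lra|apply Rmax_r]. }
  assert (H2 : differentiable_pt_lim (fun a b => exp a) s t (exp s) 0).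
  { apply differentiable_pt_lim_proj1_0. apply is_derive_Reals.
    auto_derive; [trivial|cbv beta; ring]. }
  assert (H3 : differentiable_pt_lim (fun a b => f b) s t 0 f').
  { apply is_derive_Reals in Hf. intro eps.
    destruct (differentiable_pt_lim_proj1_0 f t s f' Hf eps) as [del Hd].
    exists del. intros u v Hu Hv. specialize (Hd v u Hv Hu). simpl in Hd.
    rewrite Rmax_comm. replace (0 * (u - s) + f' * (v - t))
      with (f' * (v - t) + 0 * (u - s)) by ring. exact Hd. }
  assert (H := differentiable_pt_lim_comp _ _ _ _ _ _ _ _ _ _ _ H1 H2 H3).
  replace (exp s * f t) with (f t * exp s + exp s * 0) by ring.
  replace (exp s * f') with (f t * 0 + exp s * f') by ring.
  exact H.
Qed.

Lemma cderiv_polar_re (f : C -> C) (s t : R) (d : C) :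
  cderiv f (polar s t) d ->
  differentiable_pt_lim (fun a b => Re (f (polar a b))) s t
    (Re (d * polar s t)) (- Im (d * polar s t)).
Proof.
  intros H.
  assert (H1 := cderiv_differentiable_re f _ _ d H).
  assert (H2 := differentiable_pt_lim_exp_mult cos (- sin t) s t (is_derive_cos t)).
  assert (H3 := differentiable_pt_lim_exp_mult sin (cos t) s t (is_derive_sin t)).
  assert (H4 := differentiable_pt_lim_comp _ _ _ _ _ _ _ _ _ _ _ H1 H2 H3).
  replace (Re (d * polar s t)) with
    (Re d * (exp s * cos t) + - Im d * (exp s * sin t))
    by (unfold polar, Re, Im; simpl; ring).
  replace (- Im (d * polar s t)) with
    (Re d * (exp s * - sin t) + - Im d * (exp s * cos t))
    by (unfold polar, Re, Im; simpl; ring).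
  exact H4.
Qed.

Lemma cderiv_polar_im (f : C -> C) (s t : R) (d : C) :
  cderiv f (polar s t) d ->
  differentiable_pt_lim (fun a b => Im (f (polar a b))) s t
    (Im (d * polar s t)) (Re (d * polar s t)).
Proof.
  intros H.
  assert (H1 := cderiv_differentiable_im f _ _ d H).
  assert (H2 := differentiable_pt_lim_exp_mult cos (- sin t) s t (is_derive_cos t)).
  assert (H3 := differentiable_pt_lim_exp_mult sin (cos t) s t (is_derive_sin t)).
  assert (H4 := differentiable_pt_lim_comp _ _ _ _ _ _ _ _ _ _ _ H1 H2 H3).
  replace (Im (d * polar s t)) with
    (Im d * (exp s * cos t) + Re d * (exp s * sin t))
    by (unfold polar, Re, Im; simpl; ring).
  replace (Re (d * polar s t)) with
    (Im d * (exp s * - sin t) + Re d * (exp s * cos t))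
    by (unfold polar, Re, Im; simpl; ring).
  exact H4.
Qed.

Lemma polar_periodic (s : R) : polar s (2 * PI) = polar s 0.
Proof. unfold polar. rewrite cos_2PI, sin_2PI, cos_0, sin_0. reflexivity. Qed.

(** Goursat on a rectangle in the variable s + i t: the sides t = 0 and t = 2 PI cancel by
    periodicity, so the mean over a circle does not depend on its radius, which is then sent to 0.
    The centre enters through a limit, so that [q] may be a difference quotient there. *)
Lemma mean_value_im (q : C -> C) (L : C) :
  (forall w : C, 0 < Cmod w < 1 -> exists d, cderiv q w d) ->
  (forall eps, 0 < eps -> exists delta, 0 < delta /\
     forall w : C, 0 < Cmod w < delta -> Cmod (q w - L) < eps) ->
  forall s : R, s < 0 ->
    ex_RInt (fun t => Im (q (polar s t))) 0 (2 * PI) /\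
    RInt (fun t => Im (q (polar s t))) 0 (2 * PI) = 2 * PI * Im L.
Proof.
  intros Hq Hq0.
  assert (Hpi := PI_RGT_0).
  assert (Hdom : forall s t, s < 0 -> 0 < Cmod (polar s t) < 1).
  { intros s t Hs. rewrite Cmod_polar. split; [apply exp_pos|].
    rewrite <- exp_0. now apply exp_increasing. }
  assert (Hint : forall s, s < 0 -> ex_RInt (fun t => Im (q (polar s t))) 0 (2 * PI)).
  { intros s Hs. apply (ex_RInt_continuous (V := R_CompleteNormedModule)).
    intros t _. destruct (Hq (polar s t)) as [d Hd]; [now apply Hdom|].
    eapply (differentiable_pt_lim_continuous_r (fun a b => Im (q (polar a b)))).
    exact (cderiv_polar_im _ _ _ _ Hd). }
  assert (Hconst : forall s1 s2, s1 <= s2 -> s2 < 0 ->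
    RInt (fun t => Im (q (polar s1 t))) 0 (2 * PI) =
    RInt (fun t => Im (q (polar s2 t))) 0 (2 * PI)).
  { intros s1 s2 H12 H2.
    (* Goursat is applied to -i q, whose integrals over the vertical sides are the circle integrals
       of Im q. *)
    assert (G : box_circulation (fun a b => Im (q (polar a b)))
      (fun a b => - Re (q (polar a b))) s1 s2 0 (2 * PI) = 0).
    { apply goursat_box; [lra..|]. intros s t Hs _.
      destruct (Hq (polar s t)) as [d Hd]; [apply Hdom; lra|].
      exists (Im (d * polar s t)), (- Re (d * polar s t)). split.
      - rewrite Ropp_involutive. now apply cderiv_polar_im.
      - intro eps. destruct (cderiv_polar_re q s t d Hd eps) as [del Hdel].
        exists del. intros u v Hu Hv. specialize (Hdel u v Hu Hv).
        rewrite <- Rabs_Ropp. eapply Rle_trans; [|exact Hdel].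
        apply Req_le; f_equal; ring. }
    unfold box_circulation in G.
    rewrite (RInt_ext (fun s => - Re (q (polar s 0)) - - Re (q (polar s (2 * PI))))
      (fun _ => 0)) in G by (intros; rewrite polar_periodic; apply Rminus_diag).
    rewrite RInt_const in G.
    rewrite (RInt_minus (V := R_CompleteNormedModule) (fun t => Im (q (polar s2 t)))
      (fun t => Im (q (polar s1 t)))) in G by (apply Hint; lra).
    unfold minus, plus, opp, scal in G; simpl in G; unfold mult in G; simpl in G. lra. }
  intros s Hs. split; [now apply Hint|].
  destruct (Req_dec (RInt (fun t => Im (q (polar s t))) 0 (2 * PI)) (2 * PI * Im L))
    as [|Hne]; [assumption|exfalso].
  set (I := RInt (fun t => Im (q (polar s t))) 0 (2 * PI)) in *.
  assert (HX : 0 < Rabs (I - 2 * PI * Im L)) by (apply Rabs_pos_lt; lra).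
  set (X := Rabs (I - 2 * PI * Im L)) in *.
  destruct (Hq0 (X / (4 * PI))) as (del & Hdel & Hsmall).
  { apply Rdiv_lt_0_compat; lra. }
  set (s1 := Rmin s (ln del - 1)).
  assert (Hs1 : s1 <= s) by apply Rmin_l.
  assert (Hs2 : exp s1 < del).
  { apply Rle_lt_trans with (exp (ln del - 1)).
    - destruct (Rmin_r s (ln del - 1)) as [h|h]; fold s1 in h;
        [left; now apply exp_increasing|now rewrite h; right].
    - rewrite <- (exp_ln del) at 2 by assumption. apply exp_increasing; lra. }
  assert (HI : I = RInt (fun t => Im (q (polar s1 t))) 0 (2 * PI))
    by (symmetry; apply Hconst; lra).
  assert (HB : Rabs (RInt (fun t => Im (q (polar s1 t)) - Im L) 0 (2 * PI)) <=
     (2 * PI - 0) * (X / (4 * PI))).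
  { apply abs_RInt_le_const; [lra| |].
    - apply (ex_RInt_minus (V := R_NormedModule)); [apply Hint; lra|apply ex_RInt_const].
    - intros t _. left. eapply Rle_lt_trans; [|apply (Hsmall (polar s1 t))].
      + eapply Rle_trans; [|apply im_le_Cmod]. apply Req_le. f_equal.
      + rewrite Cmod_polar. split; [apply exp_pos|assumption]. }
  rewrite (RInt_minus (V := R_CompleteNormedModule) (fun t => Im (q (polar s1 t)))
    (fun _ => Im L)) in HB by (try apply ex_RInt_const; apply Hint; lra).
  rewrite RInt_const, <- HI in HB.
  unfold minus, plus, opp, scal in HB; simpl in HB; unfold mult in HB; simpl in HB.
  replace (I + - ((2 * PI - 0) * Im L)) with (I - 2 * PI * Im L) in HB by ring.
  fold X in HB.
  replace ((2 * PI - 0) * (X / (4 * PI))) with (X / 2) in HB by (field; lra).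
  lra.
Qed.

(** * The Schwarz lemma and the infinitesimal Schwarz-Pick inequality *)

(* On the circle [|w| = r] the kernel [2 + w/r + r/w] equals [2 + 2 cos t >= 0],
   so the mean of [f w * (2 + w/r + r/w)] has nonnegative imaginary part. *)
Lemma schwarz_disk_aux (f : C -> C) (d : C) (r : R) :
  (forall w : C, Cmod w < 1 -> exists d, cderiv f w d) ->
  (forall w : C, Cmod w < 1 -> 0 <= Im (f w)) ->
  cderiv f 0 d -> 0 < r < 1 -> 0 <= Im (2 * f 0 + r * d)%C.
Proof.
  intros Hf Him Hd Hr.
  assert (Hpi := PI_RGT_0).
  (* The kernel term r/w multiplies f(w) - f(0), so that [q] has the limit 2 f(0) + r d at the
     origin. The omitted f(0) r/w has mean zero on the circle; its imaginary part is put back below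
     as [k]. *)
  set (q := fun w : C => (2 * f w + f w * (w * / r) + (f w - f 0) * (r * / w))%C).
  assert (Hr0 : RtoC r <> 0) by (apply RtoC_neq; lra).
  destruct (mean_value_im q (2 * f 0 + r * d)%C) with (s := ln r) as [Hi1 Hi2].
  - intros w [Hw0 Hw1]. destruct (Hf w Hw1) as [dw Hdw].
    assert (Hwn : w <> 0) by now apply Cmod_gt_0.
    eexists. unfold q.
    apply cderiv_plus; [apply cderiv_plus|].
    + apply (cderiv_scal 2 f); exact Hdw.
    + apply (cderiv_mult f (fun w => (w * / r)%C)); [exact Hdw|].
      apply (cderiv_mult (fun w => w) (fun _ => (/ r)%C)); [apply cderiv_id|apply cderiv_const].
    + apply (cderiv_mult (fun w => (f w - f 0)%C) (fun w => (r * / w)%C)).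
      * apply (cderiv_minus f (fun _ => f 0)); [exact Hdw|apply cderiv_const].
      * apply (cderiv_mult (fun _ => RtoC r) (fun w => (/ w)%C)); [apply cderiv_const|].
        now apply cderiv_inv.
  - intros eps Heps.
    assert (He8 : 0 < eps / 8) by lra.
    destruct (Hd _ He8) as (d1 & Hd1 & K1).
    destruct (cderiv_cont f 0 d Hd (Rmin (eps / 8) 1)) as (d2 & Hd2 & K2).
    { apply Rmin_pos; lra. }
    assert (HF : 0 <= Cmod (f 0)) by apply Cmod_ge_0.
    set (d3 := eps * r / (4 * (Cmod (f 0) + 1))).
    assert (Hd3 : 0 < d3).
    { apply Rdiv_lt_0_compat; [apply Rmult_lt_0_compat; lra|lra]. }
    exists (Rmin d1 (Rmin d2 d3)). split; [repeat apply Rmin_pos; assumption|].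
    intros w [Hw0 Hw].
    assert (m1 := Rmin_l d1 (Rmin d2 d3)). assert (m2 := Rmin_r d1 (Rmin d2 d3)).
    assert (m3 := Rmin_l d2 d3). assert (m4 := Rmin_r d2 d3).
    assert (Ew : (w - 0)%C = w) by ring.
    specialize (K1 w); specialize (K2 w). rewrite Ew in K1, K2.
    specialize (K1 ltac:(lra)). specialize (K2 ltac:(lra)).
    assert (n1 := Rmin_l (eps / 8) 1). assert (n2 := Rmin_r (eps / 8) 1).
    assert (Hwn : w <> 0) by now apply Cmod_gt_0.
    replace (q w - (2 * f 0 + r * d))%C with
      (2 * (f w - f 0) + (f 0 + (f w - f 0)) * (w * / r) +
        r * ((f w - f 0 - d * w) * / w))%C by (unfold q; field; auto).
    eapply Rle_lt_trans; [apply Cmod_triangle|].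
    eapply Rle_lt_trans; [apply Rplus_le_compat_r, Cmod_triangle|].
    rewrite !Cmod_mult, !Cmod_inv, !Cmod_R by assumption.
    rewrite (Rabs_pos_eq r), (Rabs_pos_eq 2) by lra.
    assert (B1 : Cmod (f 0 + (f w - f 0)) <= Cmod (f 0) + 1).
    { eapply Rle_trans; [apply Cmod_triangle|]. lra. }
    assert (B2 : Cmod w * / r <= d3 * / r).
    { apply Rmult_le_compat_r; [left; apply Rinv_0_lt_compat|]; lra. }
    assert (B3 : (Cmod (f 0) + 1) * (d3 * / r) = eps / 4) by (unfold d3; field; lra).
    assert (B4 : Cmod (f 0 + (f w - f 0)) * (Cmod w * / r) <= eps / 4).
    { rewrite <- B3. apply Rmult_le_compat; try assumption; [apply Cmod_ge_0|].
      apply Rmult_le_pos; [lra|left; apply Rinv_0_lt_compat; lra]. }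
    assert (B5 : Cmod (f w - f 0 - d * w) * / Cmod w <= eps / 8).
    { apply Rle_div_l; lra. }
    assert (B6 : 0 <= Cmod (f w - f 0 - d * w) * / Cmod w).
    { apply Rmult_le_pos; [apply Cmod_ge_0|left; apply Rinv_0_lt_compat; lra]. }
    nra.
  - rewrite <- ln_1. now apply ln_increasing.
  - set (k := fun t => Im (f 0) * cos t - Re (f 0) * sin t).
    assert (Hk : is_RInt k 0 (2 * PI) 0).
    { replace 0 with (minus (Im (f 0) * sin (2 * PI) + Re (f 0) * cos (2 * PI))
        (Im (f 0) * sin 0 + Re (f 0) * cos 0)) at 2.
      - apply (is_RInt_derive (fun t => Im (f 0) * sin t + Re (f 0) * cos t)).
        + intros t _. unfold k. auto_derive; [trivial|]. ring.
        + intros t _. apply continuity_pt_filterlim. unfold k.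
          apply continuity_pt_minus; apply continuity_pt_scal;
            [apply continuity_cos|apply continuity_sin].
      - rewrite sin_2PI, cos_2PI, sin_0, cos_0. unfold minus, plus, opp; simpl. ring. }
    assert (Hsum : 0 <= RInt (fun t => Im (q (polar (ln r) t)) + k t) 0 (2 * PI)).
    { apply RInt_ge_0; [lra| |].
      - apply (ex_RInt_plus (V := R_NormedModule)); [exact Hi1|now exists 0].
      - intros t _.
        assert (Hp : polar (ln r) t = (r * cos t, r * sin t))
          by (unfold polar; now rewrite exp_ln).
        set (w := polar (ln r) t) in *.
        assert (Hcm : Cmod w = r) by (unfold w; rewrite Cmod_polar; now apply exp_ln).
        assert (Hwn : w <> 0) by (apply Cmod_gt_0; lra).
        assert (E1 : (w * / r)%C = (cos t, sin t)).
        { replace w with (r * (cos t, sin t))%C.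
          - field; assumption.
          - rewrite Hp. unfold Cmult, RtoC; simpl; f_equal; ring. }
        assert (E2 : (r * / w)%C = (cos t, (- sin t)%R)).
        { replace (RtoC r) with (w * (cos t, (- sin t)%R))%C.
          - field; assumption.
          - rewrite Hp. unfold Cmult, RtoC; simpl; f_equal; [|cbv beta; ring].
            transitivity (r * (Rsqr (sin t) + Rsqr (cos t))); [unfold Rsqr; ring|].
            rewrite sin2_cos2; ring. }
        unfold q. rewrite E1, E2.
        replace (Im (2 * f w + f w * (cos t, sin t) + (f w - f 0) * (cos t, (- sin t)%R)) + k t)
          with (Im (f w) * (2 * (1 + cos t)))
          by (unfold k, Im, Re; simpl; ring).
        assert (h := COS_bound t).
        apply Rmult_le_pos; [apply Him|]; lra. }
    rewrite (RInt_plus (V := R_CompleteNormedModule) (fun t => Im (q (polar (ln r) t))) k) in Hsum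
      by (try exact Hi1; now exists 0).
    rewrite Hi2, (is_RInt_unique _ _ _ _ Hk) in Hsum.
    change (0 <= 2 * PI * Im (2 * f 0 + r * d)%C + 0) in Hsum.
    apply (Rmult_le_reg_l (2 * PI)); lra.
Qed.

(** Rotating the disk turns the derivative into -i |d|, and the auxiliary inequality becomes r |d|
    <= 2 Im f(0) for every r < 1. *)
Lemma schwarz_disk (f : C -> C) (d : C) :
  (forall w : C, Cmod w < 1 -> exists d, cderiv f w d) ->
  (forall w : C, Cmod w < 1 -> 0 <= Im (f w)) ->
  cderiv f 0 d -> Cmod d <= 2 * Im (f 0).
Proof.
  intros Hf Him Hd.
  assert (H0 : 0 <= Im (f 0)) by (apply Him; rewrite Cmod_0; lra).
  destruct (Rle_lt_dec (Cmod d) (2 * Im (f 0))) as [|Hlt]; [assumption|exfalso].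
  assert (Hdp : 0 < Cmod d) by lra.
  assert (Hdn : d <> 0) by now apply Cmod_gt_0.
  assert (Hcn : RtoC (Cmod d) <> 0) by (apply RtoC_neq; lra).
  set (c := (- Ci * Cconj d * / Cmod d)%C).
  assert (Hcd : (c * d)%C = (- Ci * Cmod d)%C).
  { unfold c. replace (- Ci * Cconj d * / Cmod d * d)%C
      with (- Ci * / Cmod d * (d * Cconj d))%C by ring.
    rewrite <- Cmod2_conj, RtoC_pow. field. assumption. }
  assert (Hc1 : Cmod c = 1).
  { unfold c. rewrite !Cmod_mult, Cmod_opp, Cmod_Ci, Cmod_conj, Cmod_inv, Cmod_R by assumption.
    rewrite Rabs_pos_eq by lra. field; lra. }
  (* Halfway between 2 Im f(0) / |d| and 1: still below 1, yet large enough to violate the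
     inequality. *)
  set (r := (1 + 2 * Im (f 0) / Cmod d) / 2).
  assert (Hq : 0 <= 2 * Im (f 0) / Cmod d < 1).
  { split; [apply Rdiv_le_0_compat; lra|]. apply Rlt_div_l; lra. }
  assert (Ec : (c * 0)%C = 0) by ring.
  assert (Hlam : forall w, cderiv (fun w => c * w)%C w c).
  { intro w. eapply cderiv_eq; [exact (cderiv_scal c _ _ _ (cderiv_id w))|cbv beta; ring]. }
  assert (H := schwarz_disk_aux (fun w => f (c * w)%C) (d * c)%C r).
  cbv beta in H. rewrite Ec in H.
  assert (HH : 0 <= Im (2 * f 0 + r * (d * c))%C).
  { apply H.
    - intros w Hw. destruct (Hf (c * w)%C) as [dw Hdw];
        [rewrite Cmod_mult, Hc1; lra|].
      exists (dw * c)%C. apply (cderiv_comp f (fun w => c * w)%C); auto.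
    - intros w Hw. apply Him. rewrite Cmod_mult, Hc1; lra.
    - apply (cderiv_comp f (fun w => c * w)%C); [now rewrite Ec|auto].
    - unfold r. lra. }
  rewrite (Cmult_comm d c), Hcd in HH.
  assert (E : Im (2 * f 0 + r * (- Ci * Cmod d))%C = 2 * Im (f 0) - r * Cmod d)
    by (unfold Im, Re; simpl; ring).
  rewrite E in HH. unfold r in HH.
  replace ((1 + 2 * Im (f 0) / Cmod d) / 2 * Cmod d) with
    (Cmod d / 2 + Im (f 0)) in HH by (field; lra).
  lra.
Qed.

Lemma schwarz_ball (f : C -> C) (z d : C) (r : R) :
  0 < r ->
  (forall w : C, Cmod (w - z) < r -> exists d, cderiv f w d) ->
  (forall w : C, Cmod (w - z) < r -> 0 <= Im (f w)) ->
  cderiv f z d -> r * Cmod d <= 2 * Im (f z).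
Proof.
  intros Hr Hf Him Hd.
  assert (Hin : forall w, Cmod w < 1 -> Cmod (z + r * w - z) < r).
  { intros w Hw. replace (z + r * w - z)%C with (r * w)%C by ring.
    rewrite Cmod_mult, Cmod_R, Rabs_pos_eq by lra. nra. }
  assert (E0 : (z + r * 0)%C = z) by ring.
  assert (Hlam := cderiv_affine z r).
  assert (H := schwarz_disk (fun w => f (z + r * w)%C) (d * r)%C).
  cbv beta in H. rewrite E0, Cmod_mult, Cmod_R, Rabs_pos_eq in H by lra.
  rewrite Rmult_comm. apply H.
  - intros w Hw. destruct (Hf _ (Hin w Hw)) as [dw Hdw].
    exists (dw * r)%C. apply (cderiv_comp f (fun w => z + r * w)%C); auto.
  - intros w Hw. apply Him; auto.
  - apply (cderiv_comp f (fun w => z + r * w)%C); [now rewrite E0|auto].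
Qed.

(** Adding i M brings the imaginary part into [0, 2M], so the Schwarz inequality does the work of
    Cauchy's integral formula, at the price of the constant 4. *)
Lemma cauchy_estimate (f : C -> C) (z d : C) (r M : R) :
  0 < r ->
  (forall w : C, Cmod (w - z) < r -> exists d, cderiv f w d) ->
  (forall w : C, Cmod (w - z) < r -> Cmod (f w) <= M) ->
  cderiv f z d -> r * Cmod d <= 4 * M.
Proof.
  intros Hr Hf HM Hd.
  assert (Hadd : forall w d, cderiv f w d -> cderiv (fun w => f w + Ci * M)%C w d).
  { intros w dw Hdw. eapply cderiv_eq;
      [exact (cderiv_plus _ _ _ _ _ Hdw (cderiv_const (Ci * M)%C w))|cbv beta; ring]. }
  assert (Him : forall w, Im (f w + Ci * M)%C = Im (f w) + M)
    by (intro w; unfold Im; simpl; ring).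
  assert (Hb : forall w, Cmod (w - z) < r -> - M <= Im (f w) <= M).
  { intros w Hw. apply Rabs_le_between. eapply Rle_trans; [apply im_le_Cmod|auto]. }
  apply Rle_trans with (2 * Im (f z + Ci * M)%C).
  - apply (schwarz_ball (fun w => f w + Ci * M)%C z d r); [assumption| | |now apply Hadd].
    + intros w Hw. destruct (Hf w Hw) as [dw Hdw]. exists dw; auto.
    + intros w Hw. rewrite Him. specialize (Hb w Hw). lra.
  - rewrite Him. assert (h := Hb z).
    unfold Cminus in h; rewrite Cplus_opp_r, Cmod_0 in h. specialize (h Hr). lra.
Qed.

(** Pick (Nevanlinna) functions. The inequality is weak so that g - id and the generator belong to
    the class even when they vanish. *)
Record pick (f : C -> C) : Prop := {
  pick_cderiv : forall z, upper z -> exists d, cderiv f z d;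
  pick_im : forall z, upper z -> 0 <= Im (f z) }.

Lemma schwarz_pick (f : C -> C) (z d : C) :
  pick f -> upper z -> cderiv f z d -> Im z * Cmod d <= Im (f z).
Proof.
  intros [Hf Him] Hz Hd. unfold upper in *.
  set (y := Im z) in *.
  (* A Cayley transform from the disk to the half-plane, with value z and derivative 2 i Im z at
     0. *)
  set (cay := fun w : C => (Re z + Ci * y * ((1 + w) * / (1 - w)))%C).
  assert (Hnz : forall w, Cmod w < 1 -> (1 - w)%C <> 0).
  { intros w Hw E. assert (h := Cmod_triangle_inv 1 w).
    rewrite E, Cmod_0, Cmod_1 in h. lra. }
  assert (Hup : forall w, Cmod w < 1 -> 0 < Im (cay w)).
  { intros [a b] Hw. assert (h := Hnz _ Hw).
    assert (Hab : a ^ 2 + b ^ 2 < 1).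
    { assert (h2 := Cmod2_alt (a, b)). simpl in h2.
      assert (h3 := Cmod_ge_0 (a, b)). nra. }
    assert (HN : 0 < (1 - a) ^ 2 + b ^ 2) by nra.
    replace (Im (cay (a, b))) with (y * ((1 - (a ^ 2 + b ^ 2)) / ((1 - a) ^ 2 + b ^ 2))).
    - apply Rmult_lt_0_compat; [assumption|]. apply Rdiv_lt_0_compat; lra.
    - unfold cay, Im, Re; simpl. field. nra. }
  assert (E0 : cay 0 = z).
  { unfold cay. replace ((1 + 0) * / (1 - 0))%C with (RtoC 1) by field.
    destruct z as [a b]; unfold y, Im, Re, Ci, RtoC, Cplus, Cmult; simpl. f_equal; ring. }
  assert (Hcay : forall w, Cmod w < 1 -> cderiv cay w
     (0 + (0 * ((1 + w) * / (1 - w)) + Ci * y *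
        ((0 + 1) * / (1 - w) + (1 + w) * (- / ((1 - w) * (1 - w)) * (0 - 1)))))%C).
  { intros w Hw. unfold cay.
    apply (cderiv_plus (fun _ => RtoC (Re z))); [apply cderiv_const|].
    apply (cderiv_mult (fun _ => Ci * y)%C (fun w => (1 + w) * / (1 - w))%C);
      [apply cderiv_const|].
    apply (cderiv_mult (fun w => 1 + w)%C (fun w => / (1 - w))%C).
    - apply (cderiv_plus (fun _ => RtoC 1) (fun w => w)); [apply cderiv_const|apply cderiv_id].
    - apply (cderiv_comp (fun w => / w)%C (fun w => 1 - w)%C).
      + now apply cderiv_inv, Hnz.
      + apply (cderiv_minus (fun _ => RtoC 1) (fun w => w)); [apply cderiv_const|apply cderiv_id]. }
  assert (H1 : Cmod 0 < 1) by (rewrite Cmod_0; lra).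
  assert (H := schwarz_disk (fun w => f (cay w)) (d * (2 * Ci * y))%C).
  cbv beta in H. rewrite E0, !Cmod_mult, Cmod_Ci, !Cmod_R, (Rabs_pos_eq 2), (Rabs_pos_eq y) in H by lra.
  enough (Cmod d * (2 * 1 * y) <= 2 * Im (f z)) by lra.
  apply H.
  - intros w Hw. destruct (Hf (cay w) (Hup w Hw)) as [dw Hdw]. eexists.
    apply (cderiv_comp f cay); [exact Hdw|]. now apply Hcay.
  - intros w Hw. apply Him, Hup, Hw.
  - replace (2 * Ci * y)%C with
     (0 + (0 * ((1 + 0) * / (1 - 0)) + Ci * y *
        ((0 + 1) * / (1 - 0) + (1 + 0) * (- / ((1 - 0) * (1 - 0)) * (0 - 1)))))%C
      by field.
    apply (cderiv_comp f cay); [now rewrite E0|]. now apply Hcay.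
Qed.

(** * Harnack and Lipschitz bounds for functions with nonnegative imaginary part *)

Definition seg (z w : C) (t : R) : C := (z + t * (w - z))%C.

Lemma seg_0 (z w : C) : seg z w 0 = z.
Proof. unfold seg. ring. Qed.

Lemma seg_1 (z w : C) : seg z w 1 = w.
Proof. unfold seg. ring. Qed.

Lemma im_minus (z w : C) : Im (z - w)%C = Im z - Im w.
Proof. reflexivity. Qed.

Lemma im_seg (z w : C) (t : R) : Im (seg z w t) = Im z + t * (Im w - Im z).
Proof. unfold seg, Im; simpl; ring. Qed.

Lemma im_seg_ge (z w : C) (t eta : R) :
  eta <= Im z -> eta <= Im w -> 0 <= t <= 1 -> eta <= Im (seg z w t).
Proof. intros. rewrite im_seg. nra. Qed.

Lemma is_derive_seg_re (f : C -> C) (z w d : C) (t : R) :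
  cderiv f (seg z w t) d ->
  is_derive (fun t => Re (f (seg z w t))) t (Re (d * (w - z))%C).
Proof.
  intro H.
  set (f2 := fun t => Re z + t * Re (w - z)%C).
  set (f3 := fun t => Im z + t * Im (w - z)%C).
  assert (E : forall s, seg z w s = (f2 s, f3 s)).
  { intro s. unfold seg, f2, f3, Re, Im.
    apply injective_projections; simpl; ring. }
  rewrite E in H.
  assert (H1 := cderiv_differentiable_re _ _ _ _ H).
  assert (H2 : derivable_pt_lim f2 t (Re (w - z)%C)).
  { apply is_derive_Reals. unfold f2. generalize (Re z) (Re (w - z)%C).
    intros a b. auto_derive; [trivial|ring]. }
  assert (H3 : derivable_pt_lim f3 t (Im (w - z)%C)).
  { apply is_derive_Reals. unfold f3. generalize (Im z) (Im (w - z)%C).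
    intros a b. auto_derive; [trivial|ring]. }
  assert (H4 := derivable_pt_lim_comp_2d _ _ _ _ _ _ _ _ H1 H2 H3).
  apply is_derive_Reals in H4.
  apply (is_derive_ext (fun t => Re (f (f2 t, f3 t)))); [intro s; now rewrite E|].
  replace (Re (d * (w - z))%C) with (Re d * Re (w - z)%C + - Im d * Im (w - z)%C)
    by (unfold Re, Im; simpl; ring).
  exact H4.
Qed.

Lemma is_derive_seg_im (f : C -> C) (z w d : C) (t : R) :
  cderiv f (seg z w t) d ->
  is_derive (fun t => Im (f (seg z w t))) t (Im (d * (w - z))%C).
Proof.
  intro H.
  assert (H1 := is_derive_seg_re _ z w _ t (cderiv_scal (- Ci)%C _ _ _ H)).
  replace (Im (d * (w - z))%C) with (Re (- Ci * d * (w - z))%C)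
    by (unfold Re, Im; simpl; ring).
  eapply is_derive_ext; [|exact H1].
  intro s. unfold Re, Im; simpl; ring.
Qed.

Lemma nonincreasing_on (p : R -> R) (a b : R) :
  a <= b ->
  (forall t, a <= t <= b -> exists l, is_derive p t l /\ l <= 0) ->
  p b <= p a.
Proof.
  intros Hab H.
  assert (HD : forall t, a <= t <= b -> is_derive p t (Derive p t) /\ Derive p t <= 0).
  { intros t Ht. destruct (H t Ht) as (l & Hl & Hl0).
    rewrite (is_derive_unique _ _ _ Hl). now split. }
  destruct (MVT_gen p a b (Derive p)) as (c & Hc & E).
  - intros t Ht. rewrite Rmin_left, Rmax_right in Ht by lra. apply HD; lra.
  - intros t Ht. rewrite Rmin_left, Rmax_right in Ht by lra.
    apply continuity_pt_filterlim, (ex_derive_continuous (K := R_AbsRing) (V := R_NormedModule)).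
    exists (Derive p t). apply HD; lra.
  - rewrite Rmin_left, Rmax_right in Hc by lra.
    destruct (HD c Hc) as [_ h]. nra.
Qed.

(** The real mean value theorem is applied to Re (conj(D) p), where D is the chord; its increment is
    |D|^2. Derivatives are asked in the open interval, since the flow has a one-sided derivative at
    time 0. *)
Lemma curve_lipschitz (p dp : R -> C) (a b M : R) :
  a <= b ->
  (forall t, a < t < b -> is_derive (fun s => Re (p s)) t (Re (dp t)) /\
     is_derive (fun s => Im (p s)) t (Im (dp t))) ->
  (forall t, a <= t <= b -> Cmod (dp t) <= M /\
     continuity_pt (fun s => Re (p s)) t /\ continuity_pt (fun s => Im (p s)) t) ->
  Cmod (p b - p a) <= M * (b - a).
Proof.
  intros Hab Hd Hc.
  set (D := (p b - p a)%C).
  set (h := fun t => Re D * Re (p t) + Im D * Im (p t)).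
  destruct (MVT_gen h a b (fun t => Re D * Re (dp t) + Im D * Im (dp t))) as (c & Hcc & E).
  - intros t Ht. rewrite Rmin_left, Rmax_right in Ht by lra.
    destruct (Hd t Ht) as (h1 & h2). unfold h.
    apply (is_derive_plus (K := R_AbsRing) (V := R_NormedModule)
      (fun t => Re D * Re (p t)) (fun t => Im D * Im (p t)));
      apply is_derive_scal; assumption.
  - intros t Ht. rewrite Rmin_left, Rmax_right in Ht by lra.
    destruct (Hc t Ht) as (_ & h1 & h2). unfold h.
    apply (continuity_pt_plus (fun t => Re D * Re (p t)) (fun t => Im D * Im (p t)));
      apply (continuity_pt_scal (fun t => _ (p t))); assumption.
  - rewrite Rmin_left, Rmax_right in Hcc by lra.
    destruct (Hc c Hcc) as (HM & _).
    assert (E2 : Cmod D ^ 2 = h b - h a).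
    { rewrite Cmod2_alt. unfold h, D, Re, Im; simpl. ring. }
    assert (E3 : Re D * Re (dp c) + Im D * Im (dp c) = Re (Cconj D * dp c)%C)
      by (unfold Re, Im; simpl; ring).
    rewrite E, E3 in E2.
    assert (h1 := re_le_Cmod (Cconj D * dp c)%C).
    rewrite Cmod_mult, Cmod_conj in h1. apply Rabs_le_between in h1.
    assert (HD := Cmod_ge_0 D). assert (HP := Cmod_ge_0 (dp c)).
    destruct (Req_dec (Cmod D) 0) as [E0|E0]; [rewrite E0; nra|].
    apply (Rmult_le_reg_l (Cmod D)); [lra|].
    replace (Cmod D * Cmod D) with (Cmod D ^ 2) by ring. rewrite E2.
    replace (Cmod D * (M * (b - a))) with (Cmod D * M * (b - a)) by ring.
    apply Rmult_le_compat_r; [lra|].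
    apply Rle_trans with (Cmod D * Cmod (dp c)); [lra|].
    apply Rmult_le_compat_l; lra.
Qed.

Lemma is_derive_continuity_pt (f : R -> R) (x l : R) : is_derive f x l -> continuity_pt f x.
Proof.
  intro H. apply continuity_pt_filterlim.
  apply (ex_derive_continuous (K := R_AbsRing) (V := R_NormedModule)). now exists l.
Qed.

Lemma cderiv_lipschitz (f : C -> C) (z w : C) (M : R) :
  (forall t, 0 <= t <= 1 -> exists d, cderiv f (seg z w t) d /\ Cmod d <= M) ->
  Cmod (f w - f z) <= M * Cmod (w - z).
Proof.
  intro H.
  assert (H' : forall t, exists d, 0 <= t <= 1 -> cderiv f (seg z w t) d /\ Cmod d <= M).
  { intro t. destruct (classic (0 <= t <= 1)) as [Ht|Ht].
    - destruct (H t Ht) as [d Hd]. now exists d.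
    - exists (RtoC 0). tauto. }
  destruct (choice_fun _ H') as [dd Hdd].
  assert (L := curve_lipschitz (fun t => f (seg z w t)) (fun t => (dd t * (w - z))%C) 0 1
    (M * Cmod (w - z))).
  cbv beta in L. rewrite seg_0, seg_1, Rminus_0_r, Rmult_1_r in L. apply L; [lra| |].
  - intros t Ht. destruct (Hdd t) as [Hd _]; [lra|].
    split; [apply is_derive_seg_re|apply is_derive_seg_im]; assumption.
  - intros t Ht. destruct (Hdd t Ht) as [Hd HM].
    split; [|split].
    + rewrite Cmod_mult. apply Rmult_le_compat_r; [apply Cmod_ge_0|assumption].
    + eapply is_derive_continuity_pt, is_derive_seg_re, Hd.
    + eapply is_derive_continuity_pt, is_derive_seg_im, Hd.
Qed.

Lemma pick_derivative (f : C -> C) (z : C) : pick f -> upper z ->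
  exists d, cderiv f z d /\ Cmod d <= Im (f z) / Im z.
Proof.
  intros Hf Hz. destruct (pick_cderiv f Hf z Hz) as [d Hd].
  exists d; split; [assumption|]. assert (h := schwarz_pick f z d Hf Hz Hd).
  apply Rle_div_r; [exact Hz|]. lra.
Qed.

(** By Schwarz-Pick, log Im f varies along the segment at rate at most |w - z| / eta. The factor exp
    (- K t) replaces the logarithm because Im f may vanish. *)
Lemma pick_harnack (f : C -> C) (z w : C) (eta : R) :
  pick f -> 0 < eta -> eta <= Im z -> eta <= Im w ->
  Im (f w) <= exp (Cmod (w - z) / eta) * Im (f z).
Proof.
  intros Hf Heta Hz Hw.
  set (K := Cmod (w - z) / eta).
  assert (HK : 0 <= K) by (apply Rdiv_le_0_compat; [apply Cmod_ge_0|assumption]).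
  set (p := fun t => Im (f (seg z w t)) * exp (- K * t)).
  assert (H : p 1 <= p 0).
  { apply nonincreasing_on; [lra|]. intros t Ht.
    assert (Hs := im_seg_ge z w t eta Hz Hw Ht).
    assert (Hu : upper (seg z w t)) by (unfold upper; lra).
    destruct (pick_derivative f _ Hf Hu) as (d & Hd & Hdb).
    assert (H1 := is_derive_seg_im f z w d t Hd).
    exists (Im (d * (w - z))%C * exp (- K * t) + Im (f (seg z w t)) * (- K * exp (- K * t))).
    split.
    - apply (is_derive_mult (K := R_AbsRing) (fun t => Im (f (seg z w t)))
        (fun t => exp (- K * t))); [exact H1| |exact Rmult_comm].
      auto_derive; [trivial|ring].
    - assert (He := exp_pos (- K * t)).
      assert (Him := pick_im f Hf _ Hu).
      enough (Im (d * (w - z))%C <= K * Im (f (seg z w t))) by nra.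
      eapply Rle_trans; [apply Rle_abs|]. eapply Rle_trans; [apply im_le_Cmod|].
      rewrite Cmod_mult.
      replace (K * Im (f (seg z w t))) with (Im (f (seg z w t)) / eta * Cmod (w - z))
        by (unfold K; field; lra).
      apply Rmult_le_compat_r; [apply Cmod_ge_0|].
      eapply Rle_trans; [exact Hdb|]. unfold Rdiv.
      apply Rmult_le_compat_l; [assumption|]. apply Rinv_le_contravar; assumption. }
  unfold p in H. rewrite seg_0, seg_1, Rmult_0_r, exp_0, Rmult_1_r, Rmult_1_r in H.
  rewrite exp_Ropp in H. assert (He := exp_pos K).
  apply (Rmult_le_compat_l (exp K)) in H; [|lra].
  replace (exp K * (Im (f w) * / exp K)) with (Im (f w)) in H by (field; lra).
  exact H.
Qed.

(** Harnack bounds Im f, hence the derivative, along the segment. The function enters only through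
    Im (f z), which makes the bound uniform over families. *)
Lemma pick_lipschitz (f : C -> C) (z w : C) (eta : R) :
  pick f -> 0 < eta -> eta <= Im z -> eta <= Im w ->
  Cmod (f w - f z) <= Cmod (w - z) / eta * exp (Cmod (w - z) / eta) * Im (f z).
Proof.
  intros Hf Heta Hz Hw.
  set (K := Cmod (w - z) / eta).
  assert (HK : 0 <= K) by (apply Rdiv_le_0_compat; [apply Cmod_ge_0|assumption]).
  replace (K * exp K * Im (f z)) with (exp K * Im (f z) / eta * Cmod (w - z))
    by (unfold K; field; lra).
  apply cderiv_lipschitz. intros t Ht.
  assert (Hs := im_seg_ge z w t eta Hz Hw Ht).
  assert (Hu : upper (seg z w t)) by (unfold upper; lra).
  destruct (pick_derivative f _ Hf Hu) as (d & Hd & Hdb).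
  exists d; split; [assumption|]. eapply Rle_trans; [exact Hdb|].
  assert (Him := pick_im f Hf _ Hu).
  assert (Him0 : 0 <= Im (f z)) by (apply pick_im; [assumption|unfold upper; lra]).
  apply Rmult_le_compat; [assumption|left; apply Rinv_0_lt_compat; lra| |
    apply Rinv_le_contravar; assumption].
  eapply Rle_trans; [exact (pick_harnack f z _ eta Hf Heta Hz Hs)|].
  apply Rmult_le_compat_r; [assumption|].
  assert (E : Cmod (seg z w t - z) / eta <= K).
  { unfold K, Rdiv. apply Rmult_le_compat_r; [left; now apply Rinv_0_lt_compat|].
    replace (seg z w t - z)%C with (t * (w - z))%C by (unfold seg; ring).
    rewrite Cmod_mult, Cmod_R, Rabs_pos_eq by lra.
    assert (h := Cmod_ge_0 (w - z)). nra. }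
  destruct E as [E|E]; [left; now apply exp_increasing|rewrite E; lra].
Qed.

Lemma im_vertical (z : C) (T : R) : Im (z + Ci * T)%C = Im z + T.
Proof. unfold Im; simpl; ring. Qed.

(** Schwarz-Pick says exactly that Im f(z) / Im z has nonpositive derivative upwards along a
    vertical line. *)
Lemma pick_vertical_ratio (f : C -> C) (z : C) (T : R) :
  pick f -> upper z -> 0 <= T ->
  Im (f (z + Ci * T)%C) / (Im z + T) <= Im (f z) / Im z.
Proof.
  intros Hf Hz HT. unfold upper in Hz.
  set (w := (z + Ci * T)%C).
  assert (Hw : Im w = Im z + T) by apply im_vertical.
  set (p := fun t => Im (f (seg z w t)) * / (Im z + T * t)).
  assert (H : p 1 <= p 0).
  { apply nonincreasing_on; [lra|]. intros t Ht.
    assert (Hs : Im (seg z w t) = Im z + T * t) by (rewrite im_seg, Hw; ring).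
    assert (HTt : 0 <= T * t) by (apply Rmult_le_pos; lra).
    assert (Hu : upper (seg z w t)) by (unfold upper; lra).
    destruct (pick_cderiv f Hf _ Hu) as (d & Hd).
    assert (Hdb := schwarz_pick f _ d Hf Hu Hd). rewrite Hs in Hdb.
    assert (H1 := is_derive_seg_im f z w d t Hd).
    exists (Im (d * (w - z))%C * / (Im z + T * t) +
       Im (f (seg z w t)) * (- T / (Im z + T * t) ^ 2)).
    split.
    - apply (is_derive_mult (K := R_AbsRing) (fun t => Im (f (seg z w t)))
        (fun t => / (Im z + T * t))); [exact H1| |exact Rmult_comm].
      generalize dependent (Im z). intros y **.
      auto_derive; [lra|field; lra].
    - assert (Him := pick_im f Hf _ Hu).
      assert (Hle : Im (d * (w - z))%C <= T * Cmod d).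
      { eapply Rle_trans; [apply Rle_abs|]. eapply Rle_trans; [apply im_le_Cmod|].
        replace (w - z)%C with (Ci * T)%C by (unfold w; ring).
        rewrite !Cmod_mult, Cmod_Ci, Cmod_R, Rabs_pos_eq by lra. lra. }
      set (Y := Im z + T * t) in *.
      assert (HY : 0 < Y) by (unfold Y; lra).
      replace (Im (d * (w - z))%C * / Y + Im (f (seg z w t)) * (- T / Y ^ 2)) with
        ((Im (d * (w - z))%C * Y - T * Im (f (seg z w t))) / Y ^ 2) by (field; lra).
      apply Rle_div_l; [apply pow_lt; lra|]. nra. }
  unfold p in H. rewrite seg_0, seg_1, Rmult_0_r, Rplus_0_r, Rmult_1_r in H.
  exact H.
Qed.

Lemma pick_vertical_lipschitz (f : C -> C) (z : C) (T : R) :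
  pick f -> upper z -> 0 <= T ->
  Cmod (f (z + Ci * T)%C - f z) <= T * (Im (f z) / Im z).
Proof.
  intros Hf Hz HT. unfold upper in Hz.
  replace (T * (Im (f z) / Im z)) with (Im (f z) / Im z * Cmod (z + Ci * T - z)).
  - apply cderiv_lipschitz. intros t Ht.
    assert (HTt : 0 <= t * T) by (apply Rmult_le_pos; lra).
    replace (seg z (z + Ci * T)%C t) with (z + Ci * (t * T)%R)%C
      by (unfold seg; rewrite RtoC_mult; ring).
    assert (Hu : upper (z + Ci * (t * T)%R)%C) by (unfold upper; rewrite im_vertical; lra).
    destruct (pick_derivative f _ Hf Hu) as (d & Hd & Hdb).
    exists d; split; [assumption|]. eapply Rle_trans; [exact Hdb|].
    rewrite im_vertical. now apply pick_vertical_ratio.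
  - replace (z + Ci * T - z)%C with (Ci * T)%C by ring.
    rewrite Cmod_mult, Cmod_Ci, Cmod_R, Rabs_pos_eq by lra. ring.
Qed.

(* A Schwarz-Pick inequality valid at all distances: join [p] to [q] by going up
   to height [|p - q|], across, and down. *)
Lemma pick_two_point (f : C -> C) (p q : C) :
  pick f -> upper p -> upper q ->
  Cmod (f p - f q) <= 10 * Cmod (p - q) * (Im (f p) / Im p + Im (f q) / Im q).
Proof.
  intros Hf Hp Hq. unfold upper in Hp, Hq.
  assert (Hfp := pick_im f Hf p Hp). assert (Hfq := pick_im f Hf q Hq).
  set (T := Cmod (p - q)).
  assert (HT : 0 <= T) by apply Cmod_ge_0.
  set (A := Im (f p) / Im p). set (B := Im (f q) / Im q).
  assert (HA : 0 <= A) by (apply Rdiv_le_0_compat; assumption).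
  assert (HB : 0 <= B) by (apply Rdiv_le_0_compat; assumption).
  assert (He := exp_le_3).
  destruct (Rlt_le_dec T (Im p / 2)) as [Hc|Hc].
  - assert (Hi := im_le_Cmod (p - q)). rewrite im_minus in Hi. fold T in Hi.
    apply Rabs_le_between in Hi.
    rewrite Cmod_minus_sym.
    eapply Rle_trans; [apply (pick_lipschitz f p q (Im p / 2)); [assumption|lra..]|].
    rewrite Cmod_minus_sym. fold T.
    assert (E : exp (T / (Im p / 2)) <= 3).
    { eapply Rle_trans; [|exact He]. left. apply exp_increasing. apply Rlt_div_l; lra. }
    replace (T / (Im p / 2) * exp (T / (Im p / 2)) * Im (f p)) with
      (exp (T / (Im p / 2)) * (2 * T * A)) by (unfold A; field; lra).
    assert (0 <= T * A) by now apply Rmult_le_pos.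
    assert (0 <= T * B) by now apply Rmult_le_pos.
    apply Rle_trans with (3 * (2 * T * A)); [|lra].
    apply Rmult_le_compat_r; lra.
  - assert (HTp : 0 < T) by lra.
    set (p' := (p + Ci * T)%C). set (q' := (q + Ci * T)%C).
    assert (Ep : Im p' = Im p + T) by apply im_vertical.
    assert (Eq : Im q' = Im q + T) by apply im_vertical.
    assert (H1 := pick_vertical_lipschitz f p T Hf Hp HT). fold p' A in H1.
    assert (H2 := pick_vertical_lipschitz f q T Hf Hq HT). fold q' B in H2.
    assert (Tp : T <= Im p') by (rewrite Ep; lra).
    assert (Tq : T <= Im q') by (rewrite Eq; lra).
    assert (H3 := pick_lipschitz f p' q' T Hf HTp Tp Tq).
    replace (q' - p')%C with (q - p)%C in H3 by (unfold q', p'; ring).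
    rewrite (Cmod_minus_sym q p) in H3. fold T in H3.
    replace (T / T) with 1 in H3 by (field; lra).
    assert (H4 : Im (f p') <= A * (3 * T)).
    { assert (h := pick_vertical_ratio f p T Hf Hp HT). fold p' A in h.
      rewrite Rle_div_l in h by lra. eapply Rle_trans; [exact h|].
      apply Rmult_le_compat_l; lra. }
    assert (H5 : 1 * exp 1 * Im (f p') <= 3 * (A * (3 * T))).
    { assert (h := exp_pos 1). assert (0 <= A * (3 * T)) by (apply Rmult_le_pos; lra).
      eapply Rle_trans; [apply Rmult_le_compat_l; [lra|exact H4]|].
      apply Rmult_le_compat_r; lra. }
    (* Going up costs T A, going across e Im f(p') <= 9 T A because Im p <= 2 T, and going down T B;
       this is where the 10 comes from. *)
    replace (f p - f q)%C with (- (f p' - f p) - (f q' - f p') + (f q' - f q))%C by ring.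
    eapply Rle_trans; [apply Cmod_triangle|].
    eapply Rle_trans; [apply Rplus_le_compat_r, Cmod_triangle_minus|].
    rewrite Cmod_opp.
    assert (0 <= T * B) by now apply Rmult_le_pos.
    lra.
Qed.

(** * Class A: behaviour at infinity and gain in height *)

Lemma classA_pick (F : C -> C) : classA F -> pick F.
Proof.
  intros [Ha Hu _]. split.
  - intros z Hz. apply ex_derive_cderiv, Ha, Hz.
  - intros z Hz. left. now apply Hu.
Qed.

(** Balls of [C_UniformSpace] are squares, whence the factor 2. *)
Lemma ball_C_Cmod (z w : C) (eps : posreal) :
  ball (M := C_UniformSpace) z eps w -> Cmod (w - z) < 2 * eps.
Proof.
  intros [H1 H2].
  eapply Rle_lt_trans; [apply Cmod_le_re_im|].
  assert (h1 : Rabs (Re (w - z)%C) < eps) by exact H1.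
  assert (h2 : Rabs (Im (w - z)%C) < eps) by exact H2. lra.
Qed.

Lemma classA_axis (F : C -> C) (eps : R) : classA F -> 0 < eps ->
  exists M, forall y, M < y -> Cmod (F (Ci * y)%C - Ci * y) <= eps * y.
Proof.
  intros [_ _ Hl] Heps.
  assert (He2 : 0 < eps / 2) by lra.
  destruct (Hl (fun w => Cmod (w - 1) < eps)) as [M HM].
  { exists (mkposreal _ He2). intros w Hw. apply ball_C_Cmod in Hw. simpl in Hw. lra. }
  exists (Rmax M 0). intros y Hy.
  assert (h1 := Rmax_l M 0). assert (h2 := Rmax_r M 0).
  specialize (HM y ltac:(lra)).
  assert (Hy0 : (Ci * y)%C <> 0).
  { apply Cmult_neq_0; [exact Ci_nz|apply RtoC_neq; lra]. }
  replace (F (Ci * y)%C - Ci * y)%C with ((F (Ci * y)%C / (Ci * y) - 1) * (Ci * y))%C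
    by (field; split; [apply RtoC_neq; lra|exact Ci_nz]).
  rewrite Cmod_mult. rewrite (Cmod_mult Ci), Cmod_Ci, Cmod_R, Rabs_pos_eq by lra.
  rewrite Rmult_1_l. apply Rmult_le_compat_r; lra.
Qed.

(** The ratio Im F / Im decreases upwards along a vertical line and should tend to 1. The limit is
    known on the imaginary axis only, so z + i T is compared with the point i Y of the same height,
    from which it is |Re z| <= eps Y away. *)
Lemma classA_im (F : C -> C) (z : C) : classA F -> upper z -> Im z <= Im (F z).
Proof.
  intros HF Hz. assert (Hp := classA_pick F HF). unfold upper in Hz.
  destruct (Rle_lt_dec (Im z) (Im (F z))) as [|Hlt]; [assumption|exfalso].
  set (q := Im (F z) / Im z).
  assert (Hq : q < 1) by (apply Rlt_div_l; lra).
  (* At height Y the axis costs eps Y and the horizontal comparison 3 eps times 2 Y. The total 7 eps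
     Y is less than (1 - q) Y. *)
  set (eps := Rmin (1 / 2) ((1 - q) / 8)).
  assert (Heps : 0 < eps) by (apply Rmin_pos; lra).
  assert (e1 := Rmin_l (1 / 2) ((1 - q) / 8)). assert (e2 := Rmin_r (1 / 2) ((1 - q) / 8)).
  fold eps in e1, e2.
  destruct (classA_axis F eps HF Heps) as [M HM].
  set (x := Rabs (Re z)). assert (Hx : 0 <= x) by apply Rabs_pos.
  assert (HXe : 0 <= x / eps) by (apply Rdiv_le_0_compat; assumption).
  set (Y := Rmax M 0 + Im z + x / eps + 1).
  assert (m1 := Rmax_l M 0). assert (m2 := Rmax_r M 0).
  assert (HYx : x <= eps * Y).
  { replace x with (eps * (x / eps)) by (field; lra).
    apply Rmult_le_compat_l; [lra|]. unfold Y; lra. }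
  specialize (HM Y ltac:(unfold Y; lra)).
  assert (HY : 0 < Y) by (unfold Y; lra).
  set (T := Y - Im z). assert (HT : 0 <= T) by (unfold T, Y; lra).
  set (w := (z + Ci * T)%C).
  assert (Hw : Im w = Y) by (unfold w; rewrite im_vertical; unfold T; ring).
  assert (HiY : Im (Ci * Y)%C = Y) by (unfold Im; simpl; ring).
  assert (R1 := pick_vertical_ratio F z T Hp Hz HT). fold w q in R1.
  replace (Im z + T) with Y in R1 by (unfold T; ring).
  rewrite Rle_div_l in R1 by lra.
  assert (Hd : Cmod (w - Ci * Y) = x).
  { replace (w - Ci * Y)%C with (RtoC (Re z)); [apply Cmod_R|].
    unfold w, T. apply injective_projections; unfold Re, Im; simpl; ring. }
  assert (R2 := pick_lipschitz F (Ci * Y)%C w Y Hp HY ltac:(lra) ltac:(lra)).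
  rewrite Hd in R2.
  assert (HxY : 0 <= x / Y <= eps).
  { split; [apply Rdiv_le_0_compat; assumption|]. apply Rle_div_l; lra. }
  assert (E : exp (x / Y) <= 3).
  { eapply Rle_trans; [|exact exp_le_3]. left. apply exp_increasing. lra. }
  assert (B1 := im_le_Cmod (F (Ci * Y)%C - Ci * Y)). rewrite im_minus, HiY in B1.
  apply Rabs_le_between in B1.
  assert (B2 := im_le_Cmod (F w - F (Ci * Y)%C)). rewrite im_minus in B2.
  apply Rabs_le_between in B2.
  assert (B3 : x / Y * exp (x / Y) <= eps * 3).
  { apply Rmult_le_compat; try lra. left; apply exp_pos. }
  assert (B4 : x / Y * exp (x / Y) * Im (F (Ci * Y)%C) <= eps * 3 * (2 * Y)).
  { apply Rmult_le_compat; [apply Rmult_le_pos; [lra|left; apply exp_pos]| |exact B3|nra].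
    apply pick_im; [assumption|]. unfold upper; lra. }
  nra.
Qed.

(** * Compact subsets of the half-plane *)

Lemma iter_upper (g : C -> C) (j : nat) (z : C) :
  classA g -> upper z -> upper (Nat.iter j g z).
Proof.
  intros Hg Hz. induction j as [|j IH]; [exact Hz|]. now apply (classA_upper g Hg).
Qed.

Lemma iter_pick (g : C -> C) (j : nat) : classA g -> pick (Nat.iter j g).
Proof.
  intros Hg. split.
  - induction j as [|j IH]; intros z Hz.
    + exists (RtoC 1). apply cderiv_id.
    + destruct (IH z Hz) as [d Hd].
      destruct (pick_cderiv g (classA_pick g Hg) _ (iter_upper g j z Hg Hz)) as [d' Hd'].
      exists (d' * d)%C. exact (cderiv_comp g (Nat.iter j g) z d' d Hd' Hd).
  - intros z Hz. left. now apply iter_upper.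
Qed.

(** This puts increments, and through them [rescaled] and the generator, under the Harnack and
    Lipschitz bounds. *)
Lemma classA_sub_id_pick (g : C -> C) : classA g -> pick (fun z => g z - z)%C.
Proof.
  intros Hg. split.
  - intros z Hz. destruct (pick_cderiv g (classA_pick g Hg) z Hz) as [d Hd].
    exists (d - 1)%C. apply cderiv_minus; [exact Hd|apply cderiv_id].
  - intros z Hz. rewrite im_minus. assert (h := classA_im g z Hg Hz). lra.
Qed.

Lemma iter_im_le (g : C -> C) (i j : nat) (z : C) : classA g -> upper z ->
  (i <= j)%nat -> Im (Nat.iter i g z) <= Im (Nat.iter j g z).
Proof.
  intros Hg Hz H. induction H as [|j H IH]; [lra|].
  exact (Rle_trans _ _ _ IH (classA_im g _ Hg (iter_upper g j z Hg Hz))).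
Qed.

Lemma Cminus_0_r (z : C) : (z - 0)%C = z.
Proof. ring. Qed.

Definition hbox (r eta : R) (z : C) : Prop := Cmod z <= r /\ eta <= Im z.

(** The constant conjunct [A] switches a ball off: in [compact_totally_bounded] it keeps only
    centres belonging to the compact set. *)
Lemma open_ball_Cmod (A : Prop) (c : C) (r : R) :
  open (T := C_UniformSpace) (fun z => A /\ Cmod (z - c) < r).
Proof.
  intros z [HA Hz].
  assert (He : 0 < (r - Cmod (z - c)) / 2) by lra.
  exists (mkposreal _ He). intros w Hw. apply ball_C_Cmod in Hw. simpl in Hw.
  split; [exact HA|].
  assert (h := Cmod_triangle (w - z) (z - c)).
  replace (w - z + (z - c))%C with (w - c)%C in h by ring. lra.
Qed.

Lemma open_im_gt (c : R) : open (T := C_UniformSpace) (fun z => c < Im z).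
Proof.
  intros z Hz.
  assert (He : 0 < (Im z - c) / 2) by lra.
  exists (mkposreal _ He). intros w Hw. apply ball_C_Cmod in Hw. simpl in Hw.
  assert (h := im_le_Cmod (w - z)). rewrite im_minus in h.
  apply Rabs_le_between in h. lra.
Qed.

Lemma compact_in_hbox (K : C -> Prop) :
  compact_set K -> (forall z, K z -> upper z) ->
  exists r eta, 0 < eta /\ forall z, K z -> hbox r eta z.
Proof.
  intros HK Hup.
  destruct (HK nat (fun n z => (True /\ Cmod (z - 0) < INR n) /\ / (INR n + 1) < Im z))
    as [l Hl].
  - intro n. apply open_and; [apply open_ball_Cmod|apply open_im_gt].
  - intros z Hz. specialize (Hup z Hz). unfold upper in Hup.
    destruct (INR_unbounded (Rmax (Cmod z) (/ Im z))) as [n Hn].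
    assert (h1 := Rmax_l (Cmod z) (/ Im z)). assert (h2 := Rmax_r (Cmod z) (/ Im z)).
    exists n. rewrite Cminus_0_r. repeat split; [lra|].
    rewrite <- (Rinv_inv (Im z)). apply Rinv_lt_contravar; [|lra].
    assert (0 < / Im z) by now apply Rinv_0_lt_compat.
    apply Rmult_lt_0_compat; lra.
  - exists (INR (list_max l)), (/ (INR (list_max l) + 1)). split.
    + apply Rinv_0_lt_compat. assert (h := pos_INR (list_max l)). lra.
    + intros z Hz. destruct (Hl z Hz) as (n & Hin & [_ H1] & H2).
      assert (Hn : (n <= list_max l)%nat).
      { assert (h := proj1 (list_max_le l (list_max l)) (le_n _)).
        rewrite Forall_forall in h. now apply h. }
      apply le_INR in Hn. rewrite Cminus_0_r in H1.
      assert (h := pos_INR n).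
      split; [lra|]. left. eapply Rle_lt_trans; [|exact H2].
      apply Rinv_le_contravar; lra.
Qed.

(** Heine-Borel by bisection: subcovers of the quarters are concatenated, and a small box lies in
    one member of the cover. *)
Lemma compact_rectangle (a b c d : R) : a <= b -> c <= d ->
  compact_set (fun z : C => a <= Re z <= b /\ c <= Im z <= d).
Proof.
  intros Hab Hcd I U HU Hcov.
  apply (box_induction (fun a b c d => exists l, forall z : C,
    (a <= Re z <= b /\ c <= Im z <= d) -> exists i, In i l /\ U i z)); [assumption..| |].
  - intros a1 b1 c1 d1 _ _ _ _ _ _ m n [l1 H1] [l2 H2] [l3 H3] [l4 H4].
    exists (l1 ++ l2 ++ l3 ++ l4). intros z [Hr Hi].
    assert (HH : exists i, (In i l1 \/ In i l2 \/ In i l3 \/ In i l4) /\ U i z).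
    { destruct (Rle_dec (Re z) m), (Rle_dec (Im z) n).
      - destruct (H1 z) as (i & ? & ?); [lra|]. exists i; tauto.
      - destruct (H2 z) as (i & ? & ?); [lra|]. exists i; tauto.
      - destruct (H3 z) as (i & ? & ?); [lra|]. exists i; tauto.
      - destruct (H4 z) as (i & ? & ?); [lra|]. exists i; tauto. }
    destruct HH as (i & Hin & Hz). exists i. rewrite !in_app_iff. tauto.
  - intros x y Hx Hy.
    destruct (Hcov (x, y)) as [i Hi]; [split; assumption|].
    destruct (HU i _ Hi) as [eps Heps].
    exists eps. split; [apply cond_pos|].
    intros a1 b1 c1 d1 Ha1 Hb1 Hc1 Hd1 h1 h2.
    exists (i :: nil). intros z [Hr Hz]. exists i. split; [now left|].
    apply Heps. split; apply Rabs_def1; unfold minus, plus, opp; simpl;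
      unfold Re, Im in *; lra.
Qed.

Lemma compact_totally_bounded (K : C -> Prop) (delta : R) : compact_set K -> 0 < delta ->
  exists l : list C, forall z, K z -> exists c, In c l /\ K c /\ Cmod (z - c) < delta.
Proof.
  intros HK Hd. apply (HK C (fun c z => K c /\ Cmod (z - c) < delta)).
  - intro c. apply open_ball_Cmod.
  - intros z Hz. exists z. split; [assumption|].
    unfold Cminus; now rewrite Cplus_opp_r, Cmod_0.
Qed.

Lemma cvg_compacts_hbox {T : Type} (Flt : (T -> Prop) -> Prop) (f : T -> C -> C)
    (h : C -> C) (r eta eps : R) :
  Filter Flt -> cvg_compacts Flt f h -> 0 < eta -> 0 < eps ->
  Flt (fun t => forall z, hbox r eta z -> Cmod (f t z - h z) < eps).
Proof.
  intros HFlt H Heta Heps.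
  destruct (Rle_lt_dec eta r) as [Hle|Hlt].
  - eapply filter_imp; [|apply (H (fun z => - r <= Re z <= r /\ eta <= Im z <= r)
      (compact_rectangle (- r) r eta r ltac:(lra) Hle)
      (fun z Hz => Rlt_le_trans _ _ _ Heta (proj1 (proj2 Hz))) (mkposreal eps Heps))].
    intros t Ht z [Hz1 Hz2]. apply Ht.
    assert (h1 := re_le_Cmod z). assert (h2 := im_le_Cmod z).
    apply Rabs_le_between in h1, h2. lra.
  (* For r < eta the box is empty. *)
  - apply filter_forall. intros t z [Hz1 Hz2].
    assert (h2 := im_le_Cmod z). apply Rabs_le_between in h2. lra.
Qed.

Lemma cvg_compacts_pointwise {T : Type} (Flt : (T -> Prop) -> Prop) (f : T -> C -> C)
    (h : C -> C) (z : C) (eps : R) :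
  Filter Flt -> cvg_compacts Flt f h -> upper z -> 0 < eps ->
  Flt (fun t => Cmod (f t z - h z) < eps).
Proof.
  intros HFlt H Hz Heps.
  eapply filter_imp; [|apply (cvg_compacts_hbox Flt f h (Cmod z) (Im z) eps HFlt H Hz Heps)].
  intros t Ht. apply Ht. split; lra.
Qed.

Lemma eventually_forall_in {A : Type} (P : A -> nat -> Prop) (l : list A) :
  (forall c, In c l -> eventually (P c)) -> eventually (fun n => forall c, In c l -> P c n).
Proof.
  induction l as [|a l IH]; intro H.
  - exists O. intros n _ c [].
  - destruct (H a (or_introl eq_refl)) as [N1 H1].
    destruct IH as [N2 H2]; [intros c Hc; apply H; now right|].
    exists (Nat.max N1 N2). intros n Hn c [<-|Hc]; [apply H1; lia|apply H2; [lia|exact Hc]].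
Qed.

(** The easy half of the Ascoli argument: a common Lipschitz constant reduces uniform convergence to
    convergence on a finite net of the compact set. *)
Lemma cvg_compacts_of_pointwise (f : nat -> C -> C) (h : C -> C) :
  (forall z eps, upper z -> 0 < eps -> eventually (fun n => Cmod (f n z - h z) < eps)) ->
  (forall r eta, 0 < eta -> exists L, eventually (fun n => forall z w,
     hbox r eta z -> hbox r eta w ->
     Cmod ((f n z - h z) - (f n w - h w)) <= L * Cmod (z - w))) ->
  cvg_compacts eventually f h.
Proof.
  intros Hp HL K HK Hup eps.
  destruct (compact_in_hbox K HK Hup) as (r & eta & Heta & Hbox).
  destruct (HL r eta Heta) as [L [N HN]].
  set (delta := eps / (2 * (Rabs L + 1))).
  assert (HRL := Rabs_pos L). assert (He := cond_pos eps).
  assert (Hdel : 0 < delta) by (apply Rdiv_lt_0_compat; lra).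
  destruct (compact_totally_bounded K delta HK Hdel) as [l Hl].
  assert (Hf : eventually (fun n => forall c, In c l -> K c -> Cmod (f n c - h c) < eps / 2)).
  { apply eventually_forall_in. intros c _.
    destruct (classic (K c)) as [Hc|Hc].
    - destruct (Hp c (eps / 2) (Hup c Hc)) as [M HM]; [lra|].
      exists M. intros n Hn _. now apply HM.
    - exists O. tauto. }
  destruct Hf as [M HM]. exists (Nat.max N M). intros n Hn z Hz.
  destruct (Hl z Hz) as (c & Hin & Hc & Hzc).
  specialize (HM n ltac:(lia) c Hin Hc).
  specialize (HN n ltac:(lia) z c (Hbox z Hz) (Hbox c Hc)).
  assert (h1 := Cmod_triangle_inv (f n z - h z) (f n c - h c)).
  assert (h2 : L * Cmod (z - c) <= Rabs L * delta).
  { eapply Rle_trans; [apply Rmult_le_compat_r; [apply Cmod_ge_0|apply Rle_abs]|].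
    apply Rmult_le_compat_l; lra. }
  assert (h3 : (Rabs L + 1) * delta = eps / 2) by (unfold delta; field; lra).
  lra.
Qed.

Lemma hbox_dist (r eta : R) (z w : C) : hbox r eta z -> hbox r eta w -> Cmod (w - z) <= 2 * r.
Proof.
  intros [h1 _] [h2 _]. eapply Rle_trans; [apply Cmod_triangle_minus|]. lra.
Qed.

Lemma exp_le_compat (x y : R) : x <= y -> exp x <= exp y.
Proof. intros [H|H]; [left; now apply exp_increasing|rewrite H; lra]. Qed.

Lemma pick_harnack_hbox (f : C -> C) (r eta : R) (z w : C) :
  pick f -> 0 < eta -> hbox r eta z -> hbox r eta w ->
  Im (f w) <= exp (2 * r / eta) * Im (f z).
Proof.
  intros Hf Heta Hz Hw. assert (Hd := hbox_dist _ _ _ _ Hz Hw).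
  destruct Hz as [_ Hz], Hw as [_ Hw].
  eapply Rle_trans; [apply (pick_harnack f z w eta Hf Heta Hz Hw)|].
  apply Rmult_le_compat_r; [apply pick_im; [assumption|unfold upper; lra]|].
  apply exp_le_compat. apply Rmult_le_compat_r; [left; now apply Rinv_0_lt_compat|assumption].
Qed.

Lemma pick_lipschitz_hbox (f : C -> C) (r eta : R) (z w : C) :
  pick f -> 0 < eta -> hbox r eta z -> hbox r eta w ->
  Cmod (f w - f z) <= exp (2 * r / eta) / eta * Im (f z) * Cmod (w - z).
Proof.
  intros Hf Heta Hz Hw. assert (Hd := hbox_dist _ _ _ _ Hz Hw).
  destruct Hz as [_ Hz], Hw as [_ Hw].
  eapply Rle_trans; [apply (pick_lipschitz f z w eta Hf Heta Hz Hw)|].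
  replace (exp (2 * r / eta) / eta * Im (f z) * Cmod (w - z)) with
    (Cmod (w - z) / eta * exp (2 * r / eta) * Im (f z)) by (field; lra).
  apply Rmult_le_compat_r; [apply pick_im; [assumption|unfold upper; lra]|].
  apply Rmult_le_compat_l; [apply Rdiv_le_0_compat; [apply Cmod_ge_0|assumption]|].
  apply exp_le_compat. apply Rmult_le_compat_r; [left; now apply Rinv_0_lt_compat|assumption].
Qed.

(** * The flow *)

Lemma generator_pick (Ft : R -> C -> C) (Phi : C -> C) : generator Ft Phi -> pick Phi.
Proof.
  intros [H _]. apply classA_sub_id_pick in H.
  replace Phi with (fun z => Phi z + z - z)%C; [exact H|].
  apply functional_extensionality. intro z. ring.
Qed.

Lemma flow_derive (Ft : R -> C -> C) (Phi : C -> C) (z : C) (t eps : R) :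
  generator Ft Phi -> upper z -> 0 <= t -> 0 < eps ->
  exists delta, 0 < delta /\ forall s, 0 <= s -> Rabs (s - t) < delta ->
    Cmod (Ft s z - Ft t z - (s - t)%R * Phi (Ft t z)) <= eps * Rabs (s - t).
Proof.
  intros [_ H] Hz Ht Heps. destruct (H z t Hz Ht) as [_ Hd].
  destruct (Hd t) with (eps := mkposreal eps Heps) as [del Hdel].
  { intros P [e HP]. exists e. intros y Hy _. now apply HP. }
  exists del. split; [apply cond_pos|]. intros s Hs Hst.
  specialize (Hdel s Hst Hs).
  rewrite scal_R_Cmult, <- Cmod_norm in Hdel. exact Hdel.
Qed.

Lemma flow_lipschitz_at (Ft : R -> C -> C) (Phi : C -> C) (z : C) (t : R) :
  generator Ft Phi -> upper z -> 0 <= t ->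
  exists delta, 0 < delta /\ forall s, 0 <= s -> Rabs (s - t) < delta ->
    Cmod (Ft s z - Ft t z) <= (Cmod (Phi (Ft t z)) + 1) * Rabs (s - t).
Proof.
  intros HG Hz Ht.
  destruct (flow_derive Ft Phi z t 1 HG Hz Ht Rlt_0_1) as (del & Hdel & H).
  exists del; split; [assumption|]. intros s Hs Hst.
  specialize (H s Hs Hst).
  assert (h := Cmod_triangle_inv (Ft s z - Ft t z) ((s - t)%R * Phi (Ft t z))).
  rewrite Cmod_mult, Cmod_R in h. lra.
Qed.

Lemma Rmax_0_lipschitz (s t : R) : Rabs (Rmax 0 s - Rmax 0 t) <= Rabs (s - t).
Proof. unfold Rmax. destruct (Rle_dec 0 s), (Rle_dec 0 t); split_Rabs; lra. Qed.

(** Clamping time with [Rmax 0] continues the flow by a constant to negative times, where [Ft] is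
    unconstrained. Continuity at 0 thereby becomes two-sided, as [continuity_pt] demands. *)
Lemma flow_continuous (Ft : R -> C -> C) (Phi : C -> C) (z : C) (t eps : R) :
  generator Ft Phi -> upper z -> 0 < eps ->
  exists delta, 0 < delta /\ forall s, Rabs (s - t) < delta ->
    Cmod (Ft (Rmax 0 s) z - Ft (Rmax 0 t) z) < eps.
Proof.
  intros HG Hz Heps.
  destruct (flow_lipschitz_at Ft Phi z (Rmax 0 t) HG Hz (Rmax_l 0 t)) as (del & Hdel & H).
  set (B := Cmod (Phi (Ft (Rmax 0 t) z)) + 1) in *.
  assert (HB : 0 < B) by (assert (h := Cmod_ge_0 (Phi (Ft (Rmax 0 t) z))); unfold B; lra).
  assert (HeB : 0 < eps / B) by now apply Rdiv_lt_0_compat.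
  exists (Rmin del (eps / B)). split; [now apply Rmin_pos|]. intros s Hs.
  assert (h1 := Rmin_l del (eps / B)). assert (h2 := Rmin_r del (eps / B)).
  assert (h3 := Rmax_0_lipschitz s t).
  eapply Rle_lt_trans; [apply H; [apply Rmax_l|lra]|].
  apply Rle_lt_trans with (B * Rabs (s - t)).
  - apply Rmult_le_compat_l; lra.
  - apply Rlt_le_trans with (B * (eps / B)); [apply Rmult_lt_compat_l; lra|].
    right. field. lra.
Qed.

Lemma Cmod_continuity_pt (p : R -> C) (q : C -> R) (t : R) :
  (forall z w, Rabs (q z - q w) <= Cmod (z - w)) ->
  (forall eps, 0 < eps -> exists delta, 0 < delta /\ forall s, Rabs (s - t) < delta ->
    Cmod (p s - p t) < eps) ->
  continuity_pt (fun s => q (p s)) t.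
Proof.
  intros Hq Hp eps Heps. destruct (Hp eps Heps) as (del & Hdel & H).
  exists del; split; [assumption|]. intros s [_ Hs].
  eapply Rle_lt_trans; [apply Hq|]. now apply H.
Qed.

Lemma re_lipschitz (z w : C) : Rabs (Re z - Re w) <= Cmod (z - w).
Proof. exact (re_le_Cmod (z - w)). Qed.

Lemma im_lipschitz (z w : C) : Rabs (Im z - Im w) <= Cmod (z - w).
Proof. exact (im_le_Cmod (z - w)). Qed.

Lemma Cmod_lipschitz (z w : C) : Rabs (Cmod z - Cmod w) <= Cmod (z - w).
Proof.
  assert (h1 := Cmod_triangle_inv z w). assert (h2 := Cmod_triangle_inv w z).
  rewrite (Cmod_minus_sym w z) in h2. apply Rabs_le. lra.
Qed.

Lemma eps_derive (f : R -> R) (t l : R) :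
  (forall eps, 0 < eps -> exists delta, 0 < delta /\ forall s, Rabs (s - t) < delta ->
     Rabs (f s - f t - (s - t) * l) <= eps * Rabs (s - t)) -> is_derive f t l.
Proof.
  intro H. apply is_derive_Reals. intros eps Heps.
  destruct (H (eps / 2)) as (del & Hdel & Hs); [lra|].
  exists (mkposreal del Hdel). intros h Hh Hhd. simpl in Hhd.
  specialize (Hs (t + h)). replace (t + h - t) with h in Hs by ring.
  specialize (Hs Hhd).
  assert (Hp : 0 < Rabs h) by now apply Rabs_pos_lt.
  replace ((f (t + h) - f t) / h - l) with ((f (t + h) - f t - h * l) / h) by (field; assumption).
  unfold Rdiv. rewrite Rabs_mult, Rabs_inv.
  apply Rle_lt_trans with (eps / 2); [|lra]. apply Rle_div_l; [assumption|]. exact Hs.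
Qed.

Lemma flow_derive_re_im (Ft : R -> C -> C) (Phi : C -> C) (z c : C) (t : R) :
  generator Ft Phi -> upper z -> 0 < t ->
  let p := fun u : R => (Ft (Rmax 0 u) z - u * c)%C in
  is_derive (fun s => Re (p s)) t (Re (Phi (Ft (Rmax 0 t) z) - c)%C) /\
  is_derive (fun s => Im (p s)) t (Im (Phi (Ft (Rmax 0 t) z) - c)%C).
Proof.
  intros HG Hz Ht p.
  assert (H : forall eps, 0 < eps -> exists delta, 0 < delta /\ forall s, Rabs (s - t) < delta ->
     Cmod (p s - p t - (s - t)%R * (Phi (Ft (Rmax 0 t) z) - c)) <= eps * Rabs (s - t)).
  { intros eps Heps.
    destruct (flow_derive Ft Phi z t eps HG Hz ltac:(lra) Heps) as (del & Hdel & H).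
    exists (Rmin del t). split; [now apply Rmin_pos|]. intros s Hs.
    assert (h1 := Rmin_l del t). assert (h2 := Rmin_r del t).
    assert (Hs0 : 0 <= s) by (apply Rabs_lt_between in Hs; lra).
    unfold p. rewrite !Rmax_right by lra.
    replace (Ft s z - s * c - (Ft t z - t * c) - (s - t)%R * (Phi (Ft t z) - c))%C with
      (Ft s z - Ft t z - (s - t)%R * Phi (Ft t z))%C by (rewrite RtoC_minus; ring).
    apply H; lra. }
  split; apply eps_derive; intros eps Heps; destruct (H eps Heps) as (del & Hdel & Hs);
    exists del; (split; [assumption|]); intros s Hst;
    (eapply Rle_trans; [|exact (Hs s Hst)]).
  - eapply Rle_trans; [|apply re_le_Cmod]. right. f_equal. unfold Re; simpl; ring.
  - eapply Rle_trans; [|apply im_le_Cmod]. right. f_equal. unfold Im; simpl; ring.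
Qed.

(** The mean value inequality for F_u(z) - u c, the deviation from motion with constant velocity c.
    Taking c = Phi at the starting point gives the local error of the Euler scheme, and c = 0 bounds
    the displacement. *)
Lemma flow_increment (Ft : R -> C -> C) (Phi : C -> C) (z c : C) (s h M : R) :
  generator Ft Phi -> upper z -> 0 <= s -> 0 <= h ->
  (forall u, s <= u <= s + h -> Cmod (Phi (Ft u z) - c) <= M) ->
  Cmod (Ft (s + h) z - Ft s z - h * c) <= M * h.
Proof.
  intros HG Hz Hs Hh HM.
  assert (L := curve_lipschitz (fun u : R => (Ft (Rmax 0 u) z - u * c)%C)
    (fun u : R => (Phi (Ft (Rmax 0 u) z) - c)%C) s (s + h) M ltac:(lra)).
  cbv beta in L. rewrite !Rmax_right in L by lra.
  replace (s + h - s) with h in L by ring.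
  replace (Ft (s + h)%R z - Ft s z - h * c)%C with
    (Ft (s + h)%R z - (s + h)%R * c - (Ft s z - s * c))%C by (rewrite RtoC_plus; ring).
  apply L.
  - intros t Ht. apply flow_derive_re_im; [assumption..|lra].
  - intros t Ht. split; [rewrite Rmax_right by lra; now apply HM|].
    assert (Hc : forall eps, 0 < eps -> exists delta, 0 < delta /\ forall u, Rabs (u - t) < delta ->
      Cmod ((Ft (Rmax 0 u) z - u * c) - (Ft (Rmax 0 t) z - t * c)) < eps).
    { intros eps Heps.
      destruct (flow_continuous Ft Phi z t (eps / 2) HG Hz) as (d1 & Hd1 & H1); [lra|].
      assert (Hcp := Cmod_ge_0 c).
      set (d2 := eps / 2 / (Cmod c + 1)).
      assert (Hd2 : 0 < d2) by (apply Rdiv_lt_0_compat; lra).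
      exists (Rmin d1 d2). split; [now apply Rmin_pos|]. intros u Hu.
      assert (h1 := Rmin_l d1 d2). assert (h2 := Rmin_r d1 d2).
      specialize (H1 u ltac:(lra)).
      replace (Ft (Rmax 0 u) z - u * c - (Ft (Rmax 0 t) z - t * c))%C with
        (Ft (Rmax 0 u) z - Ft (Rmax 0 t) z - (u - t)%R * c)%C by (rewrite RtoC_minus; ring).
      eapply Rle_lt_trans; [apply Cmod_triangle_minus|]. rewrite Cmod_mult, Cmod_R.
      assert (h3 : Rabs (u - t) * Cmod c <= d2 * (Cmod c + 1)).
      { apply Rmult_le_compat; [apply Rabs_pos|assumption|lra..]. }
      assert (h4 : d2 * (Cmod c + 1) = eps / 2) by (unfold d2; field; lra).
      lra. }
    split.
    + apply (Cmod_continuity_pt _ Re t re_lipschitz Hc).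
    + apply (Cmod_continuity_pt _ Im t im_lipschitz Hc).
Qed.

Lemma pick_bounded_hbox (f : C -> C) (r eta : R) : pick f -> 0 < eta ->
  exists M, 0 <= M /\ (forall z, hbox r eta z -> Cmod (f z) <= M) /\
    (forall z w, hbox r eta z -> hbox r eta w -> Cmod (f w - f z) <= M * Cmod (w - z)).
Proof.
  intros Hf Heta.
  destruct (classic (exists z0, hbox r eta z0)) as [[z0 Hz0]|Hn].
  - set (E := exp (2 * r / eta)).
    assert (HE : 0 < E) by apply exp_pos.
    assert (H0 : 0 <= Im (f z0)).
    { apply pick_im; [assumption|]. destruct Hz0. unfold upper; lra. }
    assert (Hr : 0 <= r) by (destruct Hz0 as [h _]; assert (h' := Cmod_ge_0 z0); lra).
    set (L := E / eta * (E * Im (f z0))).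
    assert (HEe : 0 <= E / eta) by (apply Rdiv_le_0_compat; lra).
    assert (HEI : 0 <= E * Im (f z0)) by (apply Rmult_le_pos; lra).
    assert (HL : 0 <= L) by (apply Rmult_le_pos; lra).
    assert (HLip : forall z w, hbox r eta z -> hbox r eta w ->
      Cmod (f w - f z) <= L * Cmod (w - z)).
    { intros z w Hz Hw.
      eapply Rle_trans; [apply (pick_lipschitz_hbox f r eta z w Hf Heta Hz Hw)|].
      apply Rmult_le_compat_r; [apply Cmod_ge_0|].
      apply Rmult_le_compat_l; [exact HEe|].
      exact (pick_harnack_hbox f r eta z0 z Hf Heta Hz0 Hz). }
    exists (Cmod (f z0) + L * (2 * r) + L).
    assert (h0 := Cmod_ge_0 (f z0)).
    assert (HLr : 0 <= L * (2 * r)) by (apply Rmult_le_pos; lra).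
    split; [lra|]. split.
    + intros z Hz. specialize (HLip z0 z Hz0 Hz).
      assert (h := Cmod_triangle_inv (f z) (f z0)).
      assert (h1 : L * Cmod (z - z0) <= L * (2 * r)).
      { apply Rmult_le_compat_l; [assumption|]. eapply hbox_dist; eassumption. }
      lra.
    + intros z w Hz Hw. eapply Rle_trans; [exact (HLip z w Hz Hw)|].
      apply Rmult_le_compat_r; [apply Cmod_ge_0|lra].
  - exists 0. split; [lra|]. split; intros; exfalso; apply Hn; eauto.
Qed.

Lemma hbox_weaken (r r' eta eta' : R) (z : C) :
  r <= r' -> eta' <= eta -> hbox r eta z -> hbox r' eta' z.
Proof. intros h1 h2 [h3 h4]. split; lra. Qed.

(** The orbit of i is continuous, hence bounded on [0, 1]. The Lipschitz bound for F_u needs only Im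
    F_u(i), so it carries this bound to the whole box; heights never decrease, which keeps [eta]. *)
Lemma flow_bounded (F : C -> C) (Ft : R -> C -> C) (Phi : C -> C) (r eta : R) :
  composition_semigroup F Ft -> generator Ft Phi -> 0 < eta ->
  exists r', forall z u, hbox r eta z -> 0 <= u <= 1 -> hbox r' eta (Ft u z).
Proof.
  intros HS HG Heta.
  assert (Hi : upper Ci) by (unfold upper; simpl; lra).
  destruct (continuity_ab_maj (fun u => Cmod (Ft (Rmax 0 u) Ci)) 0 1 Rle_0_1) as [v [Hv _]].
  { intros c _. apply (Cmod_continuity_pt (fun u => Ft (Rmax 0 u) Ci) Cmod c Cmod_lipschitz).
    intros eps Heps. now apply (flow_continuous Ft Phi). }
  set (B := Cmod (Ft (Rmax 0 v) Ci)) in *.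
  (* Enlarges the box so that it also contains the reference point i. *)
  set (r1 := Rmax r 1). set (e1 := Rmin eta 1).
  assert (He1 : 0 < e1) by (apply Rmin_pos; lra).
  set (E := exp (2 * r1 / e1) / e1).
  assert (HE : 0 <= E) by (apply Rdiv_le_0_compat; [left; apply exp_pos|assumption]).
  exists (B + E * B * (2 * r1)). intros z u Hz Hu.
  assert (HA := semigroup_classA F Ft HS u (proj1 Hu)).
  assert (Hup : upper z) by (destruct Hz; unfold upper; lra).
  split.
  - assert (Hz1 : hbox r1 e1 z) by (eapply hbox_weaken; [apply Rmax_l|apply Rmin_l|exact Hz]).
    assert (Hi1 : hbox r1 e1 Ci).
    { split; [rewrite Cmod_Ci; apply Rmax_r|apply Rmin_r]. }
    assert (HB := Hv u Hu). rewrite Rmax_right in HB by lra.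
    assert (L := pick_lipschitz_hbox (Ft u) r1 e1 Ci z (classA_pick _ HA) He1 Hi1 Hz1).
    fold E in L.
    assert (h := Cmod_triangle_inv (Ft u z) (Ft u Ci)).
    assert (hI : Im (Ft u Ci) <= B).
    { eapply Rle_trans; [apply Rle_abs|]. eapply Rle_trans; [apply im_le_Cmod|exact HB]. }
    assert (hI0 := pick_im _ (classA_pick _ HA) Ci Hi).
    assert (hd := hbox_dist r1 e1 Ci z Hi1 Hz1).
    assert (E * Im (Ft u Ci) * Cmod (z - Ci) <= E * B * (2 * r1)).
    { apply Rmult_le_compat; [now apply Rmult_le_pos|apply Cmod_ge_0| |exact hd].
      now apply Rmult_le_compat_l. }
    lra.
  - destruct Hz as [_ Hz]. assert (h := classA_im _ z HA Hup). lra.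
Qed.

(** The Pick function is the iterate g^j itself, compared at b and g(b). One more iteration
    multiplies the height by at most 1 + q, and only the displacement at the single point b
    enters. *)
Lemma iter_im_growth (g : C -> C) (b : C) (eta delta : R) (j : nat) :
  classA g -> 0 < eta -> eta <= Im b -> Cmod (g b - b) <= delta ->
  Im (Nat.iter j g b) <= (1 + delta / eta * exp (delta / eta)) ^ j * Im b.
Proof.
  intros Hg Heta Hb Hd.
  assert (Hup : upper b) by (unfold upper; lra).
  assert (Hdel : 0 <= delta) by (assert (h := Cmod_ge_0 (g b - b)); lra).
  set (q := delta / eta * exp (delta / eta)).
  assert (Hde : 0 <= delta / eta) by now apply Rdiv_le_0_compat.
  assert (Hq : 0 <= q) by (apply Rmult_le_pos; [assumption|left; apply exp_pos]).
  induction j as [|j IH]; [simpl; lra|].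
  assert (Hp := iter_pick g j Hg).
  assert (Hgb := classA_im g b Hg Hup).
  assert (L := pick_lipschitz (Nat.iter j g) b (g b) eta Hp Heta Hb ltac:(lra)).
  rewrite <- Nat.iter_succ_r in L.
  assert (hI := im_lipschitz (Nat.iter (S j) g b) (Nat.iter j g b)).
  apply Rabs_le_between in hI.
  assert (H0 := pick_im _ Hp b Hup).
  assert (L2 : Cmod (g b - b) / eta * exp (Cmod (g b - b) / eta) <= q).
  { assert (h : Cmod (g b - b) / eta <= delta / eta).
    { apply Rmult_le_compat_r; [left; now apply Rinv_0_lt_compat|assumption]. }
    apply Rmult_le_compat; [apply Rdiv_le_0_compat; [apply Cmod_ge_0|assumption]|
      left; apply exp_pos|exact h|now apply exp_le_compat]. }
  assert (L3 := Rmult_le_compat_r _ _ _ H0 L2).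
  replace ((1 + q) ^ S j * Im b) with ((1 + q) * ((1 + q) ^ j * Im b)) by (simpl; ring).
  apply Rle_trans with ((1 + q) * Im (Nat.iter j g b)); [lra|].
  apply Rmult_le_compat_l; lra.
Qed.

Lemma pow_1_plus_le_exp (x : R) (j : nat) : 0 <= x -> (1 + x) ^ j <= exp (INR j * x).
Proof.
  intro Hx. induction j as [|j IH]; [simpl; rewrite Rmult_0_l, exp_0; lra|].
  rewrite S_INR. replace ((INR j + 1) * x) with (x + INR j * x) by ring.
  rewrite exp_plus. simpl. apply Rmult_le_compat; [lra|apply pow_le; lra| |assumption].
  apply exp_ineq1_le.
Qed.

(** * Convergence of the Euler scheme *)

(* Stability of the Euler scheme comes from the Schwarz-Pick contraction
   of the iterates of [g], so no Lipschitz bound on [Phi] has to be iterated. *)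
Lemma euler_step_stable (g : C -> C) (a b : C) (eta r delta tau : R) (k j : nat) :
  classA g -> 0 < eta -> eta <= Im b -> Im b <= r -> eta <= Im a ->
  Cmod (g b - b) <= delta / INR k -> (j <= k)%nat -> (0 < k)%nat -> 0 <= delta ->
  Cmod (a - b) <= tau -> tau <= 1 ->
  Cmod (Nat.iter j g a - Nat.iter j g b) <=
    tau * (exp (1 / eta) / eta * (exp (delta / eta * exp (delta / eta)) * r)).
Proof.
  intros Hg Heta Hb Hbr Ha Hgb Hj Hk Hdel Hab Htau.
  assert (Hp := iter_pick g j Hg).
  eapply Rle_trans; [apply (pick_lipschitz _ b a eta Hp Heta Hb Ha)|].
  assert (HK1 : 1 <= INR k) by (apply (le_INR 1 k); lia).
  assert (Hjk := le_INR _ _ Hj). assert (Hj0 := pos_INR j).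
  assert (Hdk : 0 <= delta / INR k) by (apply Rdiv_le_0_compat; lra).
  assert (Hdk1 : delta / INR k <= delta).
  { apply Rle_div_l; [lra|]. nra. }
  assert (Hie : 0 < / eta) by now apply Rinv_0_lt_compat.
  assert (HI : Im (Nat.iter j g b) <= exp (delta / eta * exp (delta / eta)) * r).
  { eapply Rle_trans; [apply (iter_im_growth g b eta (delta / INR k) j Hg Heta Hb Hgb)|].
    assert (H0 : 0 <= delta / INR k / eta) by (apply Rmult_le_pos; lra).
    assert (H1 : 0 <= delta / INR k / eta * exp (delta / INR k / eta)).
    { apply Rmult_le_pos; [assumption|left; apply exp_pos]. }
    apply Rmult_le_compat; [apply pow_le; lra|lra| |assumption].
    eapply Rle_trans; [now apply pow_1_plus_le_exp|]. apply exp_le_compat.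
    replace (INR j * (delta / INR k / eta * exp (delta / INR k / eta))) with
      (INR j / INR k * (delta / eta) * exp (delta / INR k / eta)) by (field; lra).
    assert (H2 : 0 <= INR j / INR k <= 1).
    { split; [apply Rdiv_le_0_compat; lra|]. apply Rle_div_l; lra. }
    assert (H3 : 0 <= delta / eta) by (apply Rmult_le_pos; lra).
    apply Rmult_le_compat; [apply Rmult_le_pos; lra|left; apply exp_pos|nra|].
    apply exp_le_compat. apply Rmult_le_compat_r; lra. }
  assert (Hc0 := Cmod_ge_0 (a - b)).
  assert (Hm0 : 0 <= Im (Nat.iter j g b)) by (apply pick_im; [exact Hp|unfold upper; lra]).
  replace (tau * (exp (1 / eta) / eta * (exp (delta / eta * exp (delta / eta)) * r))) with
    (tau / eta * exp (1 / eta) * (exp (delta / eta * exp (delta / eta)) * r)) by (field; lra).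
  assert (H1 : Cmod (a - b) / eta <= tau / eta) by (apply Rmult_le_compat_r; lra).
  assert (H2 : 0 <= Cmod (a - b) / eta) by (apply Rmult_le_pos; lra).
  apply Rmult_le_compat; [apply Rmult_le_pos; [assumption|left; apply exp_pos]|assumption| |
    assumption].
  apply Rmult_le_compat; [assumption|left; apply exp_pos|assumption|].
  apply exp_le_compat. apply Rmult_le_compat_r; lra.
Qed.

Lemma euler_convergence (g : nat -> C -> C) (F : C -> C) (k : nat -> nat)
    (Ft : R -> C -> C) (Phi : C -> C) :
  (forall n, classA (g n)) -> (forall B, eventually (fun n => B < INR (k n))) ->
  composition_semigroup F Ft -> generator Ft Phi ->
  cvg_compacts eventually (fun n z => (RtoC (INR (k n)) * (g n z - z))%C) Phi ->
  cvg_compacts eventually (fun n z => Nat.iter (k n) (g n) z) F.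
Proof.
  intros Hg Hk HS HG Hcv K HK Hup eps.
  destruct (compact_in_hbox K HK Hup) as (r & eta & Heta & Hbox).
  destruct (flow_bounded F Ft Phi r eta HS HG Heta) as [r1 Hr1].
  assert (HPp := generator_pick Ft Phi HG).
  destruct (pick_bounded_hbox Phi r1 eta HPp Heta) as (M & HM0 & HM & HL).
  assert (He := cond_pos eps).
  (* Bounds k_n |g_n(w) - w| on the box: |Phi| <= M there, plus an approximation error below 1. *)
  set (delta := M + 1).
  set (C1 := exp (1 / eta) / eta * (exp (delta / eta * exp (delta / eta)) * (Rabs r1 + 1))).
  assert (HC1 : 0 < C1).
  { unfold C1. apply Rmult_lt_0_compat; [apply Rdiv_lt_0_compat; [apply exp_pos|assumption]|].
    apply Rmult_lt_0_compat; [apply exp_pos|]. assert (h := Rabs_pos r1); lra. }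
  (* The accumulated error will be 2 e1 C1 <= eps / 2, and e1 <= 1/2 keeps each local error within
     the range of [euler_step_stable]. *)
  set (e1 := Rmin (1 / 2) (eps / (4 * C1))).
  assert (He1 : 0 < e1) by (apply Rmin_pos; [lra|apply Rdiv_lt_0_compat; lra]).
  assert (He1a : e1 <= 1 / 2) by apply Rmin_l.
  assert (He1b : e1 * C1 <= eps / 4).
  { apply Rle_trans with (eps / (4 * C1) * C1); [|right; field; lra].
    apply Rmult_le_compat_r; [lra|apply Rmin_r]. }
  destruct (cvg_compacts_hbox eventually _ _ r1 eta e1 _ Hcv Heta He1) as [N1 HN1].
  (* During a time 1/k_n the flow moves by at most M / k_n, so Phi changes along it by at most M^2 /
     k_n <= e1. *)
  destruct (Hk (1 + M * M / e1)) as [N2 HN2].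
  exists (Nat.max N1 N2). intros n Hn z HKz.
  assert (Hz := Hbox z HKz). assert (Huz := Hup z HKz).
  specialize (HN1 n ltac:(lia)). specialize (HN2 n ltac:(lia)).
  cbv beta in HN1, HN2.
  set (kn := k n) in *. set (G := g n) in *. assert (HGA : classA G) by apply Hg.
  assert (HMM : 0 <= M * M / e1).
  { apply Rdiv_le_0_compat; [apply Rmult_le_pos|]; lra. }
  assert (Hk1 : 1 < INR kn) by lra.
  assert (Hkpos : (0 < kn)%nat) by (apply INR_lt; simpl; lra).
  assert (Hkn0 : RtoC (INR kn) <> 0) by (apply RtoC_neq; lra).
  assert (Hik : 0 < / INR kn) by (apply Rinv_0_lt_compat; lra).
  assert (HMk : M * (M * / INR kn) <= e1).
  { apply (Rmult_le_reg_r (INR kn)); [lra|].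
    replace (M * (M * / INR kn) * INR kn) with (M * M) by (field; lra).
    apply Rle_trans with (e1 * (M * M / e1)); [right; field; lra|].
    apply Rmult_le_compat_l; lra. }
  assert (Happrox : forall w, hbox r1 eta w -> Cmod (G w - w - / INR kn * Phi w) <= e1 * / INR kn).
  { intros w Hw. specialize (HN1 w Hw).
    replace (G w - w - / INR kn * Phi w)%C with
      (/ INR kn * (INR kn * (G w - w) - Phi w))%C by (field; assumption).
    rewrite Cmod_mult, Cmod_inv, Cmod_R, Rabs_pos_eq, Rmult_comm by (assumption || lra).
    apply Rmult_le_compat_r; lra. }
  assert (Hmove : forall w, hbox r1 eta w -> Cmod (G w - w) <= delta / INR kn).
  { intros w Hw. specialize (Happrox w Hw). specialize (HM w Hw).
    assert (h := Cmod_triangle_inv (G w - w) (/ INR kn * Phi w)).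
    rewrite Cmod_mult, Cmod_inv, Cmod_R, Rabs_pos_eq in h by (assumption || lra).
    unfold delta, Rdiv. assert (/ INR kn * Cmod (Phi w) <= M * / INR kn).
    { rewrite Rmult_comm. apply Rmult_le_compat_r; lra. }
    assert (e1 * / INR kn <= 1 * / INR kn) by (apply Rmult_le_compat_r; lra).
    lra. }
  assert (Hloc : forall s, 0 <= s -> s + / INR kn <= 1 ->
    Cmod (G (Ft s z) - Ft (s + / INR kn) z) <= 2 * e1 * / INR kn).
  { intros s Hs Hs1.
    set (w := Ft s z).
    assert (Hw : hbox r1 eta w) by (apply Hr1; [assumption|lra]).
    assert (Hinc : Cmod (Ft (s + / INR kn) z - w - (/ INR kn)%R * Phi w) <= e1 * / INR kn).
    { apply (flow_increment Ft Phi z (Phi w) s); [assumption..|lra|].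
      intros u Hu.
      assert (Hu1 : hbox r1 eta (Ft u z)) by (apply Hr1; [assumption|lra]).
      eapply Rle_trans; [apply (HL _ _ Hw Hu1)|].
      apply Rle_trans with (M * (M * / INR kn)); [|exact HMk].
      apply Rmult_le_compat_l; [assumption|].
      assert (I := flow_increment Ft Phi z 0 s (u - s) M HG Huz Hs ltac:(lra)).
      replace (s + (u - s)) with u in I by ring.
      replace (Ft u z - Ft s z - (u - s)%R * 0)%C with (Ft u z - w)%C in I
        by (unfold w; ring).
      eapply Rle_trans; [apply I|apply Rmult_le_compat_l; lra].
      intros v Hv. rewrite Cminus_0_r. apply HM. apply Hr1; [assumption|lra]. }
    specialize (Happrox w Hw). rewrite RtoC_inv in Hinc by lra.
    replace (G w - Ft (s + / INR kn)%R z)%C with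
      ((G w - w - / INR kn * Phi w) - (Ft (s + / INR kn)%R z - w - / INR kn * Phi w))%C by ring.
    eapply Rle_trans; [apply Cmod_triangle_minus|]. lra. }
  (* Hybrid orbits follow the flow up to time j / k_n and then apply g_n for the remaining m steps.
     Consecutive ones differ by one local error pushed through m iterates. *)
  assert (Htel : forall j m, (j + m = kn)%nat ->
    Cmod (Nat.iter kn G z - Nat.iter m G (Ft (INR j * / INR kn) z)) <=
      INR j * (2 * e1 * / INR kn * C1)).
  { induction j as [|j IH]; intros m Hjm.
    - simpl in Hjm. subst m. simpl INR. rewrite !Rmult_0_l, (semigroup_0 F Ft HS z Huz).
      unfold Cminus. rewrite Cplus_opp_r, Cmod_0. lra.
    - specialize (IH (S m) ltac:(lia)). rewrite Nat.iter_succ_r in IH.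
      assert (Hj0 := pos_INR j).
      assert (Hjm' : INR j + 1 + INR m = INR kn).
      { rewrite <- Hjm, plus_INR, S_INR. ring. }
      assert (Hm0 := pos_INR m).
      set (s := INR j * / INR kn) in *.
      assert (Es : INR (S j) * / INR kn = s + / INR kn) by (rewrite S_INR; unfold s; ring).
      rewrite Es.
      assert (Hs0 : 0 <= s) by (apply Rmult_le_pos; lra).
      assert (Hs1 : s + / INR kn <= 1).
      { rewrite <- Es, S_INR. apply Rle_div_l; lra. }
      set (b := Ft (s + / INR kn) z) in *. set (a := G (Ft s z)) in *.
      assert (Hb : hbox r1 eta b) by (apply Hr1; [assumption|lra]).
      assert (Hw : hbox r1 eta (Ft s z)) by (apply Hr1; [assumption|lra]).
      assert (Huw : upper (Ft s z)) by (destruct Hw; unfold upper; lra).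
      assert (Hai := classA_im G _ HGA Huw). fold a in Hai.
      assert (Hbi := im_le_Cmod b). apply Rabs_le_between in Hbi.
      assert (Hrr := Rle_abs r1).
      assert (St := euler_step_stable G a b eta (Rabs r1 + 1) delta (2 * e1 * / INR kn) kn m
        HGA Heta (proj2 Hb) ltac:(destruct Hb; lra) ltac:(destruct Hw; lra) (Hmove b Hb)
        ltac:(lia) Hkpos ltac:(unfold delta; lra) (Hloc s Hs0 Hs1)).
      fold C1 in St.
      assert (Hle1 : / INR kn <= 1).
      { rewrite <- Rinv_1. apply Rinv_le_contravar; lra. }
      specialize (St ltac:(nra)).
      assert (T := Cmod_triangle (Nat.iter kn G z - Nat.iter m G a) (Nat.iter m G a - Nat.iter m G b)).
      replace (Nat.iter kn G z - Nat.iter m G a + (Nat.iter m G a - Nat.iter m G b))%C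
        with (Nat.iter kn G z - Nat.iter m G b)%C in T by ring.
      rewrite S_INR. lra. }
  specialize (Htel kn O ltac:(lia)). simpl Nat.iter in Htel at 2.
  rewrite Rinv_r in Htel by lra. rewrite (semigroup_1 F Ft HS z Huz) in Htel.
  eapply Rle_lt_trans; [exact Htel|].
  replace (INR kn * (2 * e1 * / INR kn * C1)) with (2 * (e1 * C1)) by (field; lra).
  lra.
Qed.

(** * Orbits with small gain in height *)

(* Each step changes [g - id] by a factor controlled by the gain in height, and the
   total gain in height is small, so [g - id] is almost constant along the orbit. *)
Lemma iter_almost_translation (g : C -> C) (w : C) (k : nat) (eps : R) :
  classA g -> upper w -> 0 <= eps -> 40 * eps <= 1 ->
  Im (Nat.iter k g w) <= (1 + eps) * Im w ->
  Cmod (Nat.iter k g w - w - INR k * (g w - w)) <= 40 * eps * (INR k * Cmod (g w - w)).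
Proof.
  intros Hg Hw Heps Heps1 Hk.
  set (W := fun j => Nat.iter j g w).
  set (y := Im w). set (a0 := Cmod (g w - w)).
  assert (Hy : 0 < y) by exact Hw.
  assert (Ha0 : 0 <= a0) by apply Cmod_ge_0.
  assert (HU : forall j, upper (W j)) by (intro j; now apply iter_upper).
  assert (Hmono : forall i j, (i <= j)%nat -> Im (W i) <= Im (W j))
    by (intros; now apply iter_im_le).
  assert (Hlow : forall j, y <= Im (W j)) by (intro j; apply (Hmono O j); lia).
  assert (HP := classA_sub_id_pick g Hg).
  set (phi := fun z => (g z - z)%C) in HP.
  assert (HWS : forall j, (W (S j) - W j)%C = phi (W j)) by reflexivity.
  (* The bracket is the sum of two telescoping sums of gains. The 20 is the 10 of [pick_two_point]
     times |phi(W j)| <= 2 a0, which the induction hypothesis itself provides since 40 eps <= 1. *)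
  assert (Hphi : forall j, (j < k)%nat ->
    Cmod (phi (W j) - phi w) <= 20 * ((Im (W (S j)) - y + (Im (W j) - y)) / y) * a0).
  { induction j as [|j IH]; intro Hj.
    - change (W O) with w. unfold Cminus at 1. rewrite Cplus_opp_r, Cmod_0.
      assert (h := Hlow 1%nat). apply Rmult_le_pos; [|assumption].
      apply Rmult_le_pos; [lra|]. apply Rdiv_le_0_compat; [fold y; lra|assumption].
    - specialize (IH ltac:(lia)).
      assert (h1 := Hmono (S j) k ltac:(lia)). assert (h2 := Hmono j k ltac:(lia)).
      change (Im (W k) <= (1 + eps) * y) in Hk.
      assert (h3 : (Im (W (S j)) - y + (Im (W j) - y)) / y <= 2 * eps).
      { apply Rle_div_l; [assumption|]. lra. }
      assert (h4 : Cmod (phi (W j)) <= 2 * a0).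
      { assert (h := Cmod_triangle_inv (phi (W j)) (phi w)).
        change (Cmod (phi w)) with a0 in h.
        assert (20 * ((Im (W (S j)) - y + (Im (W j) - y)) / y) * a0 <= 1 * a0).
        { apply Rmult_le_compat_r; lra. }
        lra. }
      assert (P2 := pick_two_point phi (W (S j)) (W j) HP (HU _) (HU _)).
      rewrite HWS in P2.
      assert (Ei : forall i, Im (phi (W i)) = Im (W (S i)) - Im (W i)) by reflexivity.
      rewrite !Ei in P2.
      assert (h5 : forall i, (Im (W (S i)) - Im (W i)) / Im (W i) <= (Im (W (S i)) - Im (W i)) / y).
      { intro i. assert (h := Hmono i (S i) ltac:(lia)). apply Rmult_le_compat_l; [lra|].
        apply Rinv_le_contravar; [assumption|apply Hlow]. }
      assert (h6 : forall i, 0 <= (Im (W (S i)) - Im (W i)) / Im (W i)).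
      { intro i. assert (h := Hmono i (S i) ltac:(lia)).
        apply Rdiv_le_0_compat; [lra|apply HU]. }
      assert (h7 : 10 * Cmod (phi (W j)) *
        ((Im (W (S (S j))) - Im (W (S j))) / Im (W (S j)) + (Im (W (S j)) - Im (W j)) / Im (W j))
        <= 10 * (2 * a0) * ((Im (W (S (S j))) - Im (W (S j))) / y + (Im (W (S j)) - Im (W j)) / y)).
      { assert (k1 := h5 (S j)). assert (k2 := h5 j). assert (k3 := h6 (S j)). assert (k4 := h6 j).
        assert (k5 := Cmod_ge_0 (phi (W j))). apply Rmult_le_compat; lra. }
      assert (T := Cmod_triangle (phi (W (S j)) - phi (W j)) (phi (W j) - phi w)).
      replace (phi (W (S j)) - phi (W j) + (phi (W j) - phi w))%C
        with (phi (W (S j)) - phi w)%C in T by ring.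
      eapply Rle_trans; [exact T|].
      eapply Rle_trans; [apply Rplus_le_compat; [eapply Rle_trans; [exact P2|exact h7]|exact IH]|].
      right. field. lra. }
  assert (Hsum : forall j, (j <= k)%nat ->
    Cmod (W j - w - INR j * phi w) <= INR j * (40 * eps * a0)).
  { induction j as [|j IH]; intro Hj.
    - change (W O) with w. simpl INR. replace (w - w - 0 * phi w)%C with (RtoC 0) by ring.
      rewrite Cmod_0. lra.
    - specialize (IH ltac:(lia)). specialize (Hphi j ltac:(lia)).
      assert (h1 := Hmono (S j) k ltac:(lia)). assert (h2 := Hmono j k ltac:(lia)).
      change (Im (W k) <= (1 + eps) * y) in Hk.
      assert (h3 : (Im (W (S j)) - y + (Im (W j) - y)) / y <= 2 * eps).
      { apply Rle_div_l; [assumption|]. lra. }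
      assert (h4 : 20 * ((Im (W (S j)) - y + (Im (W j) - y)) / y) * a0 <= 40 * eps * a0).
      { apply Rmult_le_compat_r; lra. }
      replace (W (S j) - w - INR (S j) * phi w)%C with
        ((W j - w - INR j * phi w) + (phi (W j) - phi w))%C
        by (rewrite S_INR, RtoC_plus, <- HWS; ring).
      eapply Rle_trans; [apply Cmod_triangle|]. rewrite S_INR. lra. }
  eapply Rle_trans; [exact (Hsum k (le_n k))|]. right. ring.
Qed.

(* Otherwise the orbit would tend to infinity nontangentially, where [F z / z -> 1]. *)
Lemma orbit_small_gain (F : C -> C) (z : C) (eps : R) :
  classA F -> upper z -> 0 < eps ->
  exists m, Im (F (Nat.iter m F z)) <= (1 + eps) * Im (Nat.iter m F z).
Proof.
  intros HF Hz Heps. apply NNPP. intro Hn.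
  set (W := fun j => Nat.iter j F z).
  assert (HU : forall j, upper (W j)) by (intro j; now apply iter_upper).
  assert (Hgrow : forall m, (1 + eps) * Im (W m) < Im (W (S m))).
  { intro m. apply Rnot_le_lt. intro h. apply Hn. now exists m. }
  set (Cst := 10 * Cmod (F z - z) * (/ Im (F z) + / Im z)).
  assert (HFz : 0 < Im (F z)) by (now apply (classA_upper F HF)).
  assert (Hz0 : 0 < Im z) by exact Hz.
  assert (i1 : 0 < / Im (F z)) by now apply Rinv_0_lt_compat.
  assert (i2 : 0 < / Im z) by now apply Rinv_0_lt_compat.
  assert (HC0 : 0 <= Cst).
  { apply Rmult_le_pos; [apply Rmult_le_pos; [lra|apply Cmod_ge_0]|lra]. }
  (* Schwarz-Pick for the m-th iterate at the points F(z) and z: the orbit's steps are bounded by a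
     constant times the height reached. *)
  assert (Hstep : forall m, Cmod (W (S m) - W m) <= Cst * Im (W (S m))).
  { intro m. assert (P2 := pick_two_point (Nat.iter m F) (F z) z (iter_pick F m HF) HFz Hz).
    rewrite <- Nat.iter_succ_r in P2. eapply Rle_trans; [exact P2|].
    unfold Cst. rewrite Rmult_assoc, (Rmult_assoc (10 * _)).
    rewrite <- !Rmult_assoc, (Rmult_assoc (10 * _)).
    apply Rmult_le_compat_l; [apply Rmult_le_pos; [lra|apply Cmod_ge_0]|].
    change (Nat.iter (S m) F z) with (W (S m)). change (Nat.iter m F z) with (W m).
    assert (h := Hgrow m). assert (h0 := HU m). unfold upper in h0.
    assert (Im (W m) * / Im z <= Im (W (S m)) * / Im z) by (apply Rmult_le_compat_r; nra).
    unfold Rdiv. lra. }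
  (* The second entry is the condition C' / (1 + eps) + Cst <= C', under which |W m| <= C' Im (W m)
     passes to the next point. *)
  set (C' := Rmax (Cmod z / Im z) (Cst * (1 + eps) / eps)).
  assert (HC'1 : Cmod z / Im z <= C') by apply Rmax_l.
  assert (HC'2 : Cst * (1 + eps) / eps <= C') by apply Rmax_r.
  assert (Hbd : forall m, Cmod (W m) <= C' * Im (W m)).
  { induction m as [|m IH].
    - change (W O) with z. rewrite Rle_div_l in HC'1 by assumption. exact HC'1.
    - assert (h1 := Hstep m). assert (h2 := Cmod_triangle_inv (W (S m)) (W m)).
      rewrite Rle_div_l in HC'2 by assumption.
      assert (h3 := Hgrow m). assert (h4 := HU m). assert (h5 := HU (S m)). unfold upper in *.
      assert (HC'0 : 0 <= C').
      { eapply Rle_trans; [|exact HC'1]. apply Rdiv_le_0_compat; [apply Cmod_ge_0|assumption]. }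
      apply (Rmult_le_reg_l (1 + eps)); [lra|].
      assert (h6 : (1 + eps) * (C' * Im (W m)) <= C' * Im (W (S m))).
      { replace ((1 + eps) * (C' * Im (W m))) with (C' * ((1 + eps) * Im (W m))) by ring.
        apply Rmult_le_compat_l; lra. }
      assert (h7 : Cst * (1 + eps) * Im (W (S m)) <= C' * eps * Im (W (S m))).
      { apply Rmult_le_compat_r; lra. }
      assert (h8 : (1 + eps) * Cmod (W (S m)) <= (1 + eps) * (C' * Im (W m) + Cst * Im (W (S m)))).
      { apply Rmult_le_compat_l; lra. }
      lra. }
  set (E := exp (C' + 1)).
  assert (HE : 0 < E) by apply exp_pos.
  destruct (classA_axis F (eps / (2 * E)) HF) as [M HM].
  { apply Rdiv_lt_0_compat; lra. }
  assert (Hbig : forall m, (1 + INR m * eps) * Im z <= Im (W m)).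
  { induction m as [|m IH]; [simpl; unfold W; simpl; lra|].
    rewrite S_INR. assert (h := Hgrow m). assert (h0 := pos_INR m).
    assert (0 <= INR m * eps * eps * Im z).
    { repeat apply Rmult_le_pos; lra. }
    nra. }
  destruct (INR_unbounded (Rmax M 0 / (eps * Im z))) as [m Hm].
  assert (HYM : M < Im (W m)).
  { assert (h := Rmax_l M 0). unfold Rgt in Hm; rewrite Rlt_div_l in Hm by (apply Rmult_lt_0_compat; lra).
    specialize (Hbig m). lra. }
  set (Y := Im (W m)) in *. specialize (HM Y HYM).
  assert (HY : 0 < Y) by apply HU.
  assert (HiY : Im (Ci * Y)%C = Y) by (unfold Im; simpl; ring).
  (* Harnack for F - id between i Y and the orbit point of the same height Y, at distance at most
     (C' + 1) Y. The gain there is at most eps Y / 2, although it was assumed to exceed eps Y. *)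
  assert (HK := pick_harnack (fun z => F z - z)%C (Ci * Y)%C (W m) Y (classA_sub_id_pick F HF)
    HY ltac:(lra) (Rle_refl _)).
  cbv beta in HK. rewrite !im_minus in HK.
  assert (h1 := im_le_Cmod (F (Ci * Y)%C - Ci * Y)). rewrite im_minus in h1.
  apply Rabs_le_between in h1.
  assert (h2 : Cmod (W m - Ci * Y) / Y <= C' + 1).
  { apply Rle_div_l; [assumption|]. eapply Rle_trans; [apply Cmod_triangle_minus|].
    rewrite Cmod_mult, Cmod_Ci, Cmod_R, Rabs_pos_eq by lra.
    assert (h := Hbd m). fold Y in h. lra. }
  apply exp_le_compat in h2. fold E in h2.
  assert (h3 := Hgrow m). fold Y in h3. change (W (S m)) with (F (W m)) in h3. fold Y in HK.
  assert (h4 : exp (Cmod (W m - Ci * Y) / Y) * (Im (F (Ci * Y)%C) - Im (Ci * Y)%C) <=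
    E * (eps / (2 * E) * Y)).
  { apply Rmult_le_compat; [left; apply exp_pos| |exact h2|lra].
    assert (h := classA_im F (Ci * Y)%C HF). unfold upper in h. rewrite HiY in *.
    specialize (h HY). lra. }
  replace (E * (eps / (2 * E) * Y)) with (eps / 2 * Y) in h4 by (field; lra).
  nra.
Qed.

(** * Convergence of the rescaled increments *)

(** Used for two sequences: the given [g] and the roots of [F] inside its semigroup. *)
Record iterates_cvg (g : nat -> C -> C) (k : nat -> nat) (F : C -> C) : Prop := {
  ic_classA : forall n, classA (g n);
  ic_unbounded : forall B, eventually (fun n => B < INR (k n));
  ic_limit : classA F;
  ic_cvg : cvg_compacts eventually (fun n z => Nat.iter (k n) (g n) z) F }.

Definition rescaled (g : nat -> C -> C) (k : nat -> nat) (n : nat) (z : C) : C :=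
  (RtoC (INR (k n)) * (g n z - z))%C.

Lemma rescaled_pick (g : nat -> C -> C) (k : nat -> nat) (n : nat) :
  classA (g n) -> pick (rescaled g k n).
Proof.
  intros Hg. destruct (classA_sub_id_pick _ Hg) as [Hd Hi]. split.
  - intros z Hz. destruct (Hd z Hz) as [d Hdz]. exists (INR (k n) * d)%C.
    exact (cderiv_scal (INR (k n)) _ z d Hdz).
  - intros z Hz. unfold rescaled. rewrite im_scal_l.
    apply Rmult_le_pos; [apply pos_INR|now apply Hi].
Qed.

(** For large n the iterate h_n loses at most eps Im w against F, so [iter_almost_translation]
    applies with 2 eps; hence 80. *)
Lemma rescaled_near (g : nat -> C -> C) (k : nat -> nat) (F : C -> C) (w : C) (eps : R) :
  iterates_cvg g k F -> upper w -> 0 < eps -> 80 * eps <= 1 ->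
  Im (F w) <= (1 + eps) * Im w ->
  eventually (fun n => Cmod (Nat.iter (k n) (g n) w - w - rescaled g k n w) <=
    80 * eps * Cmod (rescaled g k n w)).
Proof.
  intros [Hg _ HF Hc] Hw Heps Heps1 HFw. unfold upper in Hw.
  assert (He : 0 < eps * Im w) by now apply Rmult_lt_0_compat.
  destruct (cvg_compacts_pointwise _ _ _ w _ _ Hc Hw He) as [N HN].
  exists N. intros n Hn. specialize (HN n Hn).
  assert (hi := im_lipschitz (Nat.iter (k n) (g n) w) (F w)). apply Rabs_le_between in hi.
  assert (H := iter_almost_translation (g n) w (k n) (2 * eps) (Hg n) Hw ltac:(lra) ltac:(lra)
    ltac:(lra)).
  unfold rescaled. rewrite Cmod_mult, Cmod_R, Rabs_pos_eq by apply pos_INR. lra.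
Qed.

(** On the orbit of i there is a point w0 of gain 1/160, where |Phi_n(w0)| <= 2 |h_n(w0) - w0|, a
    convergent quantity. Harnack and Lipschitz bounds spread this to the box. *)
Lemma rescaled_bounded (g : nat -> C -> C) (k : nat -> nat) (F : C -> C) (r eta : R) :
  iterates_cvg g k F -> 0 < eta ->
  exists M, 0 <= M /\ eventually (fun n =>
    (forall z, hbox r eta z -> Cmod (rescaled g k n z) <= M) /\
    (forall z w, hbox r eta z -> hbox r eta w ->
       Cmod (rescaled g k n w - rescaled g k n z) <= M * Cmod (w - z))).
Proof.
  intros H Heta.
  assert (Hi : upper Ci) by (unfold upper; simpl; lra).
  destruct (orbit_small_gain F Ci (1 / 160) (ic_limit _ _ _ H) Hi) as [m Hm]; [lra|].
  set (w0 := Nat.iter m F Ci) in *.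
  assert (Hw0 : upper w0) by (apply iter_upper; [apply (ic_limit _ _ _ H)|exact Hi]).
  destruct (rescaled_near g k F w0 (1 / 160) H Hw0) as [N1 HN1]; [lra|lra|exact Hm|].
  destruct (cvg_compacts_pointwise _ _ _ w0 1 _ (ic_cvg _ _ _ H) Hw0 Rlt_0_1)
    as [N2 HN2].
  set (B := 2 * (Cmod (F w0 - w0) + 1)).
  assert (HB0 : 0 <= B) by (unfold B; assert (h := Cmod_ge_0 (F w0 - w0)); lra).
  assert (HB : forall n, (Nat.max N1 N2 <= n)%nat -> Cmod (rescaled g k n w0) <= B).
  { intros n Hn. specialize (HN1 n ltac:(lia)). specialize (HN2 n ltac:(lia)).
    cbv beta in HN1, HN2.
    set (hw := Nat.iter (k n) (g n) w0) in *. set (X := rescaled g k n w0) in *.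
    assert (h1 := Cmod_triangle_inv X (hw - w0)).
    replace (X - (hw - w0))%C with (- (hw - w0 - X))%C in h1 by ring.
    rewrite Cmod_opp in h1.
    assert (h2 := Cmod_triangle_inv (hw - w0) (F w0 - w0)).
    replace (hw - w0 - (F w0 - w0))%C with (hw - F w0)%C in h2 by ring.
    unfold B. lra. }
  set (r1 := Rmax r (Cmod w0)). set (e1 := Rmin eta (Im w0)).
  assert (He1 : 0 < e1) by (apply Rmin_pos; [assumption|exact Hw0]).
  assert (Hw0b : hbox r1 e1 w0) by (split; [apply Rmax_r|apply Rmin_r]).
  assert (Hsub : forall z, hbox r eta z -> hbox r1 e1 z).
  { intros z. apply hbox_weaken; [apply Rmax_l|apply Rmin_l]. }
  assert (Hr1 : 0 <= r1) by (eapply Rle_trans; [apply Cmod_ge_0|apply Rmax_r]).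
  set (E := exp (2 * r1 / e1)). assert (HE : 0 < E) by apply exp_pos.
  set (L := E / e1 * (E * B)).
  assert (HEe : 0 <= E / e1) by (apply Rdiv_le_0_compat; lra).
  assert (HL : 0 <= L) by (apply Rmult_le_pos; [assumption|apply Rmult_le_pos; lra]).
  assert (HLr : 0 <= L * (2 * r1)) by (apply Rmult_le_pos; lra).
  exists (B + L * (2 * r1) + L). split; [lra|].
  exists (Nat.max N1 N2). intros n Hn. specialize (HB n Hn).
  assert (HP := rescaled_pick g k n (ic_classA _ _ _ H n)).
  assert (HLip : forall z w, hbox r1 e1 z -> hbox r1 e1 w ->
    Cmod (rescaled g k n w - rescaled g k n z) <= L * Cmod (w - z)).
  { intros z w Hz Hw.
    eapply Rle_trans; [apply (pick_lipschitz_hbox _ r1 e1 z w HP He1 Hz Hw)|].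
    apply Rmult_le_compat_r; [apply Cmod_ge_0|]. apply Rmult_le_compat_l; [assumption|].
    eapply Rle_trans; [apply (pick_harnack_hbox _ r1 e1 w0 z HP He1 Hw0b Hz)|].
    apply Rmult_le_compat_l; [left; exact HE|].
    eapply Rle_trans; [apply Rle_abs|]. eapply Rle_trans; [apply im_le_Cmod|exact HB]. }
  split.
  - intros z Hz. apply Hsub in Hz. assert (h := HLip w0 z Hw0b Hz).
    assert (h1 := Cmod_triangle_inv (rescaled g k n z) (rescaled g k n w0)).
    assert (L * Cmod (z - w0) <= L * (2 * r1)).
    { apply Rmult_le_compat_l; [assumption|]. eapply hbox_dist; eassumption. }
    lra.
  - intros z w Hz Hw. eapply Rle_trans; [apply HLip; now apply Hsub|].
    apply Rmult_le_compat_r; [apply Cmod_ge_0|lra].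
Qed.

(** Meant for h_n - F, which is uniformly small but whose imaginary part has no sign, so the Pick
    bounds do not cover it. *)
Lemma cauchy_lipschitz (f : C -> C) (z w : C) (r M : R) :
  0 < r -> Cmod (w - z) <= r ->
  (forall v, Cmod (v - z) < 2 * r -> (exists d, cderiv f v d) /\ Cmod (f v) <= M) ->
  Cmod (f w - f z) <= 4 * M / r * Cmod (w - z).
Proof.
  intros Hr Hw Hf. apply cderiv_lipschitz. intros t Ht.
  assert (Hs : Cmod (seg z w t - z) <= r).
  { replace (seg z w t - z)%C with (t * (w - z))%C by (unfold seg; ring).
    rewrite Cmod_mult, Cmod_R, Rabs_pos_eq by lra.
    assert (h := Cmod_ge_0 (w - z)). nra. }
  assert (Hin : forall v, Cmod (v - seg z w t) < r -> Cmod (v - z) < 2 * r).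
  { intros v Hv. assert (h := Cmod_triangle (v - seg z w t) (seg z w t - z)).
    replace (v - seg z w t + (seg z w t - z))%C with (v - z)%C in h by ring. lra. }
  destruct (Hf (seg z w t)) as [[d Hd] _]; [lra|].
  exists d; split; [assumption|]. apply Rle_div_r; [assumption|].
  rewrite Rmult_comm. apply (cauchy_estimate f (seg z w t) d r M); [assumption| | |assumption];
    intros v Hv; apply Hf; auto.
Qed.

(* [g n] commutes with its iterate; linearize that iterate at [z]. *)
Lemma rescaled_functional_equation (g : nat -> C -> C) (k : nat -> nat) (F : C -> C)
    (z d : C) (eps : R) :
  iterates_cvg g k F -> upper z -> cderiv F z d -> 0 < eps ->
  eventually (fun n => Cmod (rescaled g k n (F z) - d * rescaled g k n z) < eps).
Proof.
  intros H Hz Hd Heps. assert (Hz' : 0 < Im z) by exact Hz.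
  assert (HF := ic_limit _ _ _ H). assert (Hc := ic_cvg _ _ _ H).
  set (r := Rmax (Cmod z) (Cmod (F z) + 1)).
  destruct (rescaled_bounded g k F r (Im z) H Hz') as (M & HM0 & N1 & HN1).
  assert (HFz := classA_im F z HF Hz).
  (* The disk of radius 2 rho about z stays above height 2 rho. *)
  set (rho := Im z / 4).
  assert (Hrho : 0 < rho) by (unfold rho; lra).
  set (sig := eps * rho / (16 * (M + 1))).
  assert (Hsig : 0 < sig).
  { apply Rdiv_lt_0_compat; [apply Rmult_lt_0_compat|]; lra. }
  set (e2 := Rmin 1 (eps / (4 * (M + 1)))).
  assert (He2 : 0 < e2) by (apply Rmin_pos; [lra|apply Rdiv_lt_0_compat; lra]).
  assert (He2a : e2 <= 1) by apply Rmin_l.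
  assert (He2b : M * e2 <= eps / 4).
  { apply Rle_trans with (M * (eps / (4 * (M + 1)))); [apply Rmult_le_compat_l; [lra|apply Rmin_r]|].
    apply Rle_trans with ((M + 1) * (eps / (4 * (M + 1)))); [|right; field; lra].
    apply Rmult_le_compat_r; [left; apply Rdiv_lt_0_compat; lra|lra]. }
  destruct (cvg_compacts_hbox eventually _ _ (Cmod z + 2 * rho) (2 * rho) sig _ Hc
    ltac:(lra) Hsig) as [N2 HN2].
  destruct (cvg_compacts_pointwise _ _ _ z e2 _ Hc Hz He2) as [N3 HN3].
  destruct (Hd (eps / (4 * (M + 1)))) as (del & Hdel & Hlin); [apply Rdiv_lt_0_compat; lra|].
  (* Forces |g_n(z) - z| <= M / k_n below both [rho] and [del], the ranges of the Cauchy estimate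
     and of the linearization of F. *)
  destruct (ic_unbounded _ _ _ H ((M + 1) / Rmin rho del)) as [N4 HN4].
  exists (Nat.max (Nat.max N1 N2) (Nat.max N3 N4)). intros n Hn.
  destruct (HN1 n ltac:(lia)) as [Hbd Hlip].
  specialize (HN2 n ltac:(lia)). specialize (HN3 n ltac:(lia)). specialize (HN4 n ltac:(lia)).
  cbv beta in HN2, HN3, HN4.
  assert (Hgn := ic_classA _ _ _ H n).
  set (G := g n) in *. set (h := Nat.iter (k n) G) in *. set (K := INR (k n)) in *.
  assert (Hmin : 0 < Rmin rho del) by now apply Rmin_pos.
  assert (HK : 0 < K).
  { eapply Rlt_trans; [|exact HN4]. apply Rdiv_lt_0_compat; lra. }
  assert (HKc : RtoC K <> 0) by (apply RtoC_neq; lra).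
  assert (Hzb : hbox r (Im z) z) by (split; [apply Rmax_l|lra]).
  assert (HFzb : hbox r (Im z) (F z)).
  { split; [|assumption]. eapply Rle_trans; [|apply Rmax_r]. lra. }
  assert (Hhz : hbox r (Im z) (h z)).
  { split.
    - assert (t := Cmod_triangle_inv (h z) (F z)). eapply Rle_trans; [|apply Rmax_r]. lra.
    - apply (iter_im_le G O (k n) z Hgn Hz). lia. }
  assert (Hphi : K * Cmod (G z - z) <= M).
  { assert (t := Hbd z Hzb). unfold rescaled in t. fold G K in t.
    rewrite Cmod_mult, Cmod_R, Rabs_pos_eq in t by lra. exact t. }
  assert (Hsmall : Cmod (G z - z) < Rmin rho del).
  { rewrite Rlt_div_l in HN4 by assumption.
    apply (Rmult_lt_reg_l K); [assumption|]. lra. }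
  assert (s1 := Rmin_l rho del). assert (s2 := Rmin_r rho del).
  assert (P1 : Cmod (rescaled g k n (h z) - rescaled g k n (F z)) <= eps / 4).
  { eapply Rle_trans; [apply (Hlip _ _ HFzb Hhz)|].
    apply Rle_trans with (M * e2); [|exact He2b]. apply Rmult_le_compat_l; lra. }
  assert (P2 : Cmod ((h (G z) - F (G z)) - (h z - F z)) <= 4 * sig / rho * Cmod (G z - z)).
  { apply (cauchy_lipschitz (fun v => h v - F v)%C); [assumption|lra|].
    intros v Hv.
    assert (Hvi := im_lipschitz v z). apply Rabs_le_between in Hvi.
    assert (Hvb : hbox (Cmod z + 2 * rho) (2 * rho) v).
    { split; [|unfold rho in *; lra]. assert (t := Cmod_triangle_inv v z). lra. }
    assert (Hvu : upper v) by (destruct Hvb; unfold upper; lra).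
    split; [|left; now apply HN2].
    destruct (pick_cderiv _ (iter_pick G (k n) Hgn) v Hvu) as [d1 Hd1].
    destruct (pick_cderiv _ (classA_pick F HF) v Hvu) as [d2 Hd2].
    exists (d1 - d2)%C. now apply cderiv_minus. }
  assert (P3 := Hlin (G z) ltac:(lra)).
  assert (Ecom : rescaled g k n (h z) = (K * (h (G z) - h z))%C).
  { unfold rescaled. fold G K. unfold h. now rewrite <- Nat.iter_succ_r. }
  (* Three errors of at most eps / 4: replacing F(z) by h(z) in Phi_n, replacing h by F in the
     increment from z to g(z), and linearizing F at z. *)
  replace (rescaled g k n (F z) - d * rescaled g k n z)%C with
    (- (rescaled g k n (h z) - rescaled g k n (F z)) +
      (K * ((h (G z) - F (G z)) - (h z - F z)) + K * (F (G z) - F z - d * (G z - z))))%C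
    by (rewrite Ecom; unfold rescaled; fold G K; ring).
  eapply Rle_lt_trans; [apply Cmod_triangle|]. rewrite Cmod_opp.
  eapply Rle_lt_trans; [apply Rplus_le_compat_l, Cmod_triangle|].
  rewrite !Cmod_mult, Cmod_R, Rabs_pos_eq by lra.
  assert (Q2 : K * Cmod (h (G z) - F (G z) - (h z - F z)) <= eps / 4).
  { apply Rle_trans with (K * (4 * sig / rho * Cmod (G z - z))); [apply Rmult_le_compat_l; lra|].
    replace (K * (4 * sig / rho * Cmod (G z - z))) with
      (4 * sig / rho * (K * Cmod (G z - z))) by ring.
    apply Rle_trans with (4 * sig / rho * (M + 1)).
    - apply Rmult_le_compat_l; [apply Rdiv_le_0_compat|]; lra.
    - unfold sig. right. field. lra. }
  assert (Q3 : K * Cmod (F (G z) - F z - d * (G z - z)) <= eps / 4).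
  { apply Rle_trans with (K * (eps / (4 * (M + 1)) * Cmod (G z - z)));
      [apply Rmult_le_compat_l; lra|].
    replace (K * (eps / (4 * (M + 1)) * Cmod (G z - z))) with
      (eps / (4 * (M + 1)) * (K * Cmod (G z - z))) by ring.
    apply Rle_trans with (eps / (4 * (M + 1)) * (M + 1)).
    - apply Rmult_le_compat_l; [left; apply Rdiv_lt_0_compat|]; lra.
    - right. field. lra. }
  lra.
Qed.

(** * The roots of F in its semigroup, and the generator as their limit *)

Lemma eventually_INR_gt (k : nat -> nat) :
  (forall n, (k n < k (S n))%nat) -> forall B, eventually (fun n => B < INR (k n)).
Proof.
  intros Hk B. destruct (INR_unbounded B) as [N HN]. exists N. intros n Hn.
  assert (Hkn : forall m, (m <= k m)%nat).
  { induction m as [|m IH]; [lia|]. specialize (Hk m). lia. }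
  assert (h := le_INR _ _ (Nat.le_trans _ _ _ Hn (Hkn n))). lra.
Qed.

Lemma semigroup_iter (F : C -> C) (Ft : R -> C -> C) (s : R) (j : nat) (z : C) :
  composition_semigroup F Ft -> 0 <= s -> upper z ->
  Nat.iter j (Ft s) z = Ft (INR j * s) z.
Proof.
  intros HS Hs Hz. induction j as [|j IH].
  - simpl INR. rewrite Rmult_0_l. symmetry. exact (semigroup_0 F Ft HS z Hz).
  - change (Nat.iter (S j) (Ft s) z) with (Ft s (Nat.iter j (Ft s) z)).
    rewrite IH, (semigroup_comp F Ft HS) by
      (assumption || (apply Rmult_le_pos; [apply pos_INR|assumption])).
    f_equal. rewrite S_INR. ring.
Qed.

Lemma semigroup_root_iter (F : C -> C) (Ft : R -> C -> C) (n : nat) (z : C) :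
  composition_semigroup F Ft -> upper z ->
  Nat.iter (S n) (Ft (/ INR (S n))) z = F z.
Proof.
  intros HS Hz. assert (h := lt_0_INR (S n) ltac:(lia)).
  rewrite (semigroup_iter F Ft _ _ z HS) by
    (assumption || (left; now apply Rinv_0_lt_compat)).
  rewrite Rinv_r by lra. exact (semigroup_1 F Ft HS z Hz).
Qed.

(* The embedding semigroup itself supplies a sequence of approximate roots of [F]
   whose rescaled increments converge to [Phi]. *)
Lemma semigroup_iterates_cvg (F : C -> C) (Ft : R -> C -> C) :
  classA F -> composition_semigroup F Ft ->
  iterates_cvg (fun n => Ft (/ INR (S n))) S F.
Proof.
  intros HF HS. split.
  - intro n. apply (semigroup_classA F Ft HS). left. apply Rinv_0_lt_compat, lt_0_INR. lia.
  - apply eventually_INR_gt. lia.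
  - exact HF.
  - intros K _ HK eps. exists O. intros n _ z Hz.
    rewrite (semigroup_root_iter F Ft n z HS (HK z Hz)).
    unfold Cminus. rewrite Cplus_opp_r, Cmod_0. apply cond_pos.
Qed.

(** These rescaled increments are the difference quotients of the flow at time 0 with step
    1/(n+1). *)
Lemma semigroup_rescaled_cvg (F : C -> C) (Ft : R -> C -> C) (Phi : C -> C) (z : C) (eps : R) :
  composition_semigroup F Ft -> generator Ft Phi -> upper z -> 0 < eps ->
  eventually (fun n => Cmod (rescaled (fun n => Ft (/ INR (S n))) S n z - Phi z) <= eps).
Proof.
  intros HS HG Hz Heps.
  destruct (flow_derive Ft Phi z 0 eps HG Hz (Rle_refl 0) Heps) as (del & Hdel & H).
  destruct (eventually_INR_gt S ltac:(lia) (/ del)) as [N HN].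
  exists N. intros n Hn. specialize (HN n Hn). cbv beta in HN.
  set (K := INR (S n)) in *.
  assert (Hid : 0 < / del) by now apply Rinv_0_lt_compat.
  assert (HK : 0 < K) by lra.
  assert (HKc : RtoC K <> 0) by (apply RtoC_neq; lra).
  assert (HiK : 0 < / K) by now apply Rinv_0_lt_compat.
  specialize (H (/ K)). rewrite Rminus_0_r, Rabs_pos_eq in H by lra.
  assert (HKd : / K < del).
  { rewrite <- (Rinv_inv del). apply Rinv_lt_contravar; [now apply Rmult_lt_0_compat|assumption]. }
  specialize (H ltac:(lra) HKd).
  rewrite (semigroup_0 F Ft HS z Hz), RtoC_inv in H by lra.
  unfold rescaled. fold K.
  replace (K * (Ft (/ K)%R z - z) - Phi z)%C with
    (K * (Ft (/ K)%R z - z - / K * Phi z))%C by (field; assumption).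
  rewrite Cmod_mult, Cmod_R, Rabs_pos_eq by lra.
  apply Rle_trans with (K * (eps * / K)); [apply Rmult_le_compat_l; lra|right; field; lra].
Qed.

(** The approximate equation for the roots [Ft (/ INR (S n))], passed to the limit. No derivatives
    in t and z have to be exchanged. *)
Lemma generator_functional_equation (F : C -> C) (Ft : R -> C -> C) (Phi : C -> C) (z d : C) :
  classA F -> composition_semigroup F Ft -> generator Ft Phi -> upper z -> cderiv F z d ->
  Phi (F z) = (d * Phi z)%C.
Proof.
  intros HF HS HG Hz Hd.
  destruct (Ceq_dec (Phi (F z)) (d * Phi z)%C) as [|Hne]; [assumption|exfalso].
  assert (HX : 0 < Cmod (Phi (F z) - d * Phi z)).
  { apply Cmod_gt_0. intro E. apply Hne. apply Ceq_minus. exact E. }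
  set (X := Cmod (Phi (F z) - d * Phi z)) in *.
  assert (HFz : upper (F z)) by now apply (classA_upper F HF).
  assert (Hd0 := Cmod_ge_0 d).
  set (e := X / (4 * (Cmod d + 1))).
  assert (He : 0 < e) by (apply Rdiv_lt_0_compat; lra).
  assert (He1 : Cmod d * e <= X / 4).
  { apply Rle_trans with ((Cmod d + 1) * e); [apply Rmult_le_compat_r; lra|].
    unfold e. right. field. lra. }
  destruct (rescaled_functional_equation _ _ F z d (X / 4) (semigroup_iterates_cvg F Ft HF HS)
    Hz Hd ltac:(lra)) as [N1 H1].
  destruct (semigroup_rescaled_cvg F Ft Phi (F z) (X / 4) HS HG HFz ltac:(lra)) as [N2 H2].
  destruct (semigroup_rescaled_cvg F Ft Phi z e HS HG Hz He) as [N3 H3].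
  set (n := Nat.max N1 (Nat.max N2 N3)).
  specialize (H1 n ltac:(lia)). specialize (H2 n ltac:(lia)). specialize (H3 n ltac:(lia)).
  set (a := rescaled (fun n => Ft (/ INR (S n))) S n (F z)) in *.
  set (b := rescaled (fun n => Ft (/ INR (S n))) S n z) in *.
  assert (E : (Phi (F z) - d * Phi z)%C = ((a - d * b) - (a - Phi (F z)) + d * (b - Phi z))%C)
    by ring.
  assert (T : X <= Cmod (a - d * b) + Cmod (a - Phi (F z)) + Cmod (d * (b - Phi z))).
  { unfold X. rewrite E. eapply Rle_trans; [apply Cmod_triangle|].
    apply Rplus_le_compat_r, Cmod_triangle_minus. }
  rewrite Cmod_mult in T.
  assert (Cmod d * Cmod (b - Phi z) <= Cmod d * e) by (apply Rmult_le_compat_l; lra).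
  lra.
Qed.

(** Limit of [rescaled_near] along the roots, whose iterates equal F exactly. *)
Lemma generator_near (F : C -> C) (Ft : R -> C -> C) (Phi : C -> C) (w : C) (eps : R) :
  classA F -> composition_semigroup F Ft -> generator Ft Phi -> upper w ->
  0 < eps -> 80 * eps <= 1 -> Im (F w) <= (1 + eps) * Im w ->
  Cmod (F w - w - Phi w) <= 80 * eps * Cmod (Phi w).
Proof.
  intros HF HS HG Hw Heps Heps1 Hgain.
  destruct (Rle_lt_dec (Cmod (F w - w - Phi w)) (80 * eps * Cmod (Phi w))) as [|Hlt];
    [assumption|exfalso].
  set (X := Cmod (F w - w - Phi w) - 80 * eps * Cmod (Phi w)).
  assert (HX : 0 < X) by (unfold X; lra).
  destruct (rescaled_near _ _ F w eps (semigroup_iterates_cvg F Ft HF HS) Hw Heps Heps1 Hgain)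
    as [N1 H1].
  destruct (semigroup_rescaled_cvg F Ft Phi w (X / 4) HS HG Hw ltac:(lra)) as [N2 H2].
  set (n := Nat.max N1 N2).
  specialize (H1 n ltac:(lia)). specialize (H2 n ltac:(lia)). cbv beta in H1.
  rewrite (semigroup_root_iter F Ft n w HS Hw) in H1.
  set (b := rescaled (fun n => Ft (/ INR (S n))) S n w) in *.
  assert (T1 := Cmod_triangle_inv b (Phi w)).
  assert (T2 := Cmod_triangle (F w - w - b) (b - Phi w)).
  replace (F w - w - b + (b - Phi w))%C with (F w - w - Phi w)%C in T2 by ring.
  assert (80 * eps * Cmod b <= 80 * eps * (Cmod (Phi w) + X / 4)).
  { apply Rmult_le_compat_l; lra. }
  assert (80 * eps * (X / 4) <= 1 * (X / 4)) by (apply Rmult_le_compat_r; lra).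
  unfold X in *. lra.
Qed.

(** * Comparison of the rescaled increments with the generator *)

(** Phi_n(w) is compared with h_n(w) - w, and Phi(w) with F(w) - w. The part 80 eps |Phi_n(w) -
    Phi(w)| <= 1/2 |Phi_n(w) - Phi(w)| is absorbed on the left, which doubles 160 to 320. *)
Lemma rescaled_error_near (g : nat -> C -> C) (k : nat -> nat) (F : C -> C)
    (Ft : R -> C -> C) (Phi : C -> C) (w : C) (eps tol : R) :
  iterates_cvg g k F -> composition_semigroup F Ft -> generator Ft Phi -> upper w ->
  0 < eps -> 160 * eps <= 1 -> Im (F w) <= (1 + eps) * Im w -> 0 < tol ->
  eventually (fun n => Cmod (rescaled g k n w - Phi w) <= 320 * eps * Cmod (Phi w) + tol).
Proof.
  intros H HS HG Hw Heps Heps1 Hgain Htol.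
  assert (HF := ic_limit _ _ _ H).
  assert (A1 := generator_near F Ft Phi w eps HF HS HG Hw Heps ltac:(lra) Hgain).
  destruct (rescaled_near g k F w eps H Hw Heps ltac:(lra) Hgain) as [N1 H1].
  destruct (cvg_compacts_pointwise _ _ _ w (tol / 2) _ (ic_cvg _ _ _ H) Hw ltac:(lra))
    as [N2 H2].
  exists (Nat.max N1 N2). intros n Hn.
  specialize (H1 n ltac:(lia)). specialize (H2 n ltac:(lia)). cbv beta in H1, H2.
  set (b := rescaled g k n w) in *. set (h := Nat.iter (k n) (g n) w) in *.
  assert (T1 := Cmod_triangle_inv b (Phi w)).
  assert (T2 : Cmod (b - Phi w) <= Cmod (h - F w) + Cmod (h - w - b) + Cmod (F w - w - Phi w)).
  { replace (b - Phi w)%C with ((h - F w) - (h - w - b) + (F w - w - Phi w))%C by ring.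
    eapply Rle_trans; [apply Cmod_triangle|]. apply Rplus_le_compat_r, Cmod_triangle_minus. }
  assert (80 * eps * Cmod b <= 80 * eps * (Cmod (Phi w) + Cmod (b - Phi w))).
  { apply Rmult_le_compat_l; lra. }
  assert (h0 := Cmod_ge_0 (b - Phi w)).
  assert (80 * eps * Cmod (b - Phi w) <= / 2 * Cmod (b - Phi w)).
  { apply Rmult_le_compat_r; lra. }
  lra.
Qed.

(** By the chain rule [l] is the derivative of the m-th iterate at z. What matters is that one
    factor serves Phi exactly and Phi_n asymptotically. *)
Lemma functional_equation_iter (g : nat -> C -> C) (k : nat -> nat) (F : C -> C)
    (Ft : R -> C -> C) (Phi : C -> C) (z : C) (m : nat) :
  iterates_cvg g k F -> composition_semigroup F Ft -> generator Ft Phi -> upper z ->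
  exists l : C, Phi (Nat.iter m F z) = (l * Phi z)%C /\
    forall eps, 0 < eps ->
      eventually (fun n => Cmod (rescaled g k n (Nat.iter m F z) - l * rescaled g k n z) < eps).
Proof.
  intros H HS HG Hz. assert (HF := ic_limit _ _ _ H).
  induction m as [|m [l [IH1 IH2]]].
  - exists (RtoC 1). split; [simpl; ring|]. intros eps Heps. exists O. intros n _.
    change (Nat.iter 0 F z) with z.
    replace (rescaled g k n z - 1 * rescaled g k n z)%C with (RtoC 0) by ring.
    now rewrite Cmod_0.
  - set (w := Nat.iter m F z) in *. change (Nat.iter (S m) F z) with (F w).
    assert (Hw : upper w) by now apply iter_upper.
    destruct (pick_cderiv F (classA_pick F HF) w Hw) as [d Hd].
    exists (d * l)%C. split.
    + rewrite (generator_functional_equation F Ft Phi w d HF HS HG Hw Hd), IH1. ring.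
    + intros eps Heps. assert (Hd0 := Cmod_ge_0 d).
      set (e := eps / (2 * (Cmod d + 1))).
      assert (He : 0 < e) by (apply Rdiv_lt_0_compat; lra).
      assert (He1 : Cmod d * e <= eps / 2).
      { apply Rle_trans with ((Cmod d + 1) * e); [apply Rmult_le_compat_r; lra|].
        unfold e. right. field. lra. }
      destruct (IH2 e He) as [N1 H1].
      destruct (rescaled_functional_equation g k F w d (eps / 2) H Hw Hd ltac:(lra)) as [N2 H2].
      exists (Nat.max N1 N2). intros n Hn.
      specialize (H1 n ltac:(lia)). specialize (H2 n ltac:(lia)). cbv beta in H1, H2.
      replace (rescaled g k n (F w) - d * l * rescaled g k n z)%C with
        ((rescaled g k n (F w) - d * rescaled g k n w) +
          d * (rescaled g k n w - l * rescaled g k n z))%C by ring.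
      eapply Rle_lt_trans; [apply Cmod_triangle|]. rewrite Cmod_mult.
      assert (Cmod d * Cmod (rescaled g k n w - l * rescaled g k n z) <= Cmod d * e).
      { apply Rmult_le_compat_l; lra. }
      lra.
Qed.

(** At a zero the Lipschitz bound has the factor Im Phi(zeta) = 0, so Phi vanishes identically and
    the flow stands still. *)
Lemma generator_zero (F : C -> C) (Ft : R -> C -> C) (Phi : C -> C) (zeta z : C) :
  composition_semigroup F Ft -> generator Ft Phi -> upper zeta -> Phi zeta = 0 ->
  upper z -> F z = z /\ Phi z = 0.
Proof.
  intros HS HG Hzeta H0 Hz.
  assert (HP := generator_pick Ft Phi HG).
  assert (HPhi : forall w, upper w -> Phi w = 0).
  { intros w Hw.
    set (eta := Rmin (Im zeta) (Im w)).
    assert (Heta : 0 < eta) by (apply Rmin_pos; assumption).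
    assert (L := pick_lipschitz Phi zeta w eta HP Heta (Rmin_l _ _) (Rmin_r _ _)).
    rewrite H0 in L. change (Im 0) with 0 in L. rewrite Rmult_0_r, Cminus_0_r in L.
    apply Cmod_eq_0. apply Rle_antisym; [assumption|apply Cmod_ge_0]. }
  split; [|now apply HPhi].
  assert (I := flow_increment Ft Phi z 0 0 1 0 HG Hz (Rle_refl 0) Rle_0_1).
  rewrite Rplus_0_l, Rmult_0_l in I.
  rewrite (semigroup_0 F Ft HS z Hz), (semigroup_1 F Ft HS z Hz) in I.
  apply Ceq_minus. apply Cmod_eq_0. apply Rle_antisym; [|apply Cmod_ge_0].
  replace (F z - z)%C with (F z - z - 1 * 0)%C by ring. apply I.
  intros u Hu. rewrite HPhi.
  - rewrite Cminus_0_r, Cmod_0. apply Rle_refl.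
  - apply (classA_upper _ (semigroup_classA F Ft HS u (proj1 Hu))). exact Hz.
Qed.

Lemma rescaled_pointwise (g : nat -> C -> C) (k : nat -> nat) (F : C -> C)
    (Ft : R -> C -> C) (Phi : C -> C) (z : C) (eps : R) :
  iterates_cvg g k F -> composition_semigroup F Ft -> generator Ft Phi -> upper z ->
  0 < eps -> eventually (fun n => Cmod (rescaled g k n z - Phi z) < eps).
Proof.
  intros H HS HG Hz Heps. assert (HF := ic_limit _ _ _ H).
  destruct (classic (exists zeta, upper zeta /\ Phi zeta = 0)) as [(zeta & Hzeta & H0)|Hn].
  - destruct (generator_zero F Ft Phi zeta z HS HG Hzeta H0 Hz) as [EF EP].
    assert (Hz' : 0 < Im z) by exact Hz.
    (* As F(z) = z, the point z itself has no gain, and the relative error term vanishes with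
       Phi(z). *)
    destruct (rescaled_error_near g k F Ft Phi z (1 / 160) (eps / 2) H HS HG Hz) as [N HN];
      try lra; [rewrite EF; lra|].
    exists N. intros n Hn. specialize (HN n Hn). rewrite EP in *. rewrite Cmod_0 in HN. lra.
  - assert (HPz := Cmod_ge_0 (Phi z)).
    (* Makes the relative error 320 e |Phi(z)| at most eps / 2 before the orbit length m is
       known. *)
    set (e := Rmin (1 / 160) (eps / (640 * (Cmod (Phi z) + 1)))).
    assert (He : 0 < e) by (apply Rmin_pos; [lra|apply Rdiv_lt_0_compat; lra]).
    assert (He1 : e <= 1 / 160) by apply Rmin_l.
    assert (He2 : 320 * e * Cmod (Phi z) < eps).
    { apply Rle_lt_trans with (320 * (eps / (640 * (Cmod (Phi z) + 1))) * (Cmod (Phi z) + 1)).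
      - apply Rmult_le_compat; try lra. apply Rmult_le_compat_l; [lra|apply Rmin_r].
      - replace (320 * (eps / (640 * (Cmod (Phi z) + 1))) * (Cmod (Phi z) + 1)) with (eps / 2)
          by (field; lra). lra. }
    destruct (orbit_small_gain F z e HF Hz He) as [m Hm].
    destruct (functional_equation_iter g k F Ft Phi z m H HS HG Hz) as (l & El & Hl).
    set (w := Nat.iter m F z) in *.
    assert (Hw : upper w) by now apply iter_upper.
    assert (Hl0 : 0 < Cmod l).
    { apply Cmod_gt_0. intro E0. apply Hn. exists w. split; [exact Hw|].
      rewrite El, E0. ring. }
    (* Chosen after m and l: two such errors, divided by |l|, fill exactly the room that the
       relative error leaves below eps. *)
    set (tol := Cmod l * (eps - 320 * e * Cmod (Phi z)) / 2).
    assert (Htol : 0 < tol).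
    { apply Rdiv_lt_0_compat; [apply Rmult_lt_0_compat|]; lra. }
    destruct (rescaled_error_near g k F Ft Phi w e tol H HS HG Hw He ltac:(lra) Hm Htol)
      as [N1 H1].
    destruct (Hl tol Htol) as [N2 H2].
    exists (Nat.max N1 N2). intros n Hnn.
    specialize (H1 n ltac:(lia)). specialize (H2 n ltac:(lia)). cbv beta in H1, H2.
    apply (Rmult_lt_reg_l (Cmod l)); [assumption|].
    rewrite <- Cmod_mult.
    replace (l * (rescaled g k n z - Phi z))%C with
      ((rescaled g k n w - Phi w) - (rescaled g k n w - l * rescaled g k n z))%C
      by (rewrite El; ring).
    eapply Rle_lt_trans; [apply Cmod_triangle_minus|].
    rewrite El, Cmod_mult in H1. rewrite El.
    replace (Cmod l * eps) with (320 * e * (Cmod l * Cmod (Phi z)) + tol + tol)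
      by (unfold tol; field).
    lra.
Qed.

Lemma rescaled_cvg (g : nat -> C -> C) (k : nat -> nat) (F : C -> C)
    (Ft : R -> C -> C) (Phi : C -> C) :
  iterates_cvg g k F -> composition_semigroup F Ft -> generator Ft Phi ->
  cvg_compacts eventually (rescaled g k) Phi.
Proof.
  intros H HS HG. apply cvg_compacts_of_pointwise.
  - intros z eps Hz Heps. now apply (rescaled_pointwise g k F Ft Phi).
  - intros r eta Heta.
    destruct (rescaled_bounded g k F r eta H Heta) as (M1 & _ & N & HN).
    destruct (pick_bounded_hbox Phi r eta (generator_pick Ft Phi HG) Heta) as (M2 & _ & _ & HL).
    exists (M1 + M2), N. intros n Hn z w Hz Hw.
    destruct (HN n Hn) as [_ HL1].
    replace (rescaled g k n z - Phi z - (rescaled g k n w - Phi w))%C with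
      ((rescaled g k n z - rescaled g k n w) - (Phi z - Phi w))%C by ring.
    eapply Rle_trans; [apply Cmod_triangle_minus|].
    specialize (HL1 w z Hw Hz). specialize (HL w z Hw Hz). lra.
Qed.

Theorem corollary1p2 (g : nat -> C -> C) (F : C -> C) (k : nat -> nat)
    (Ft : R -> C -> C) (Phi : C -> C)
    (hg : forall n : nat, classA (g n))
    (hF : infinitely_divisible F)
    (hk_pos : forall n : nat, (0 < k n)%nat)
    (hk_incr : forall n : nat, (k n < k (S n))%nat)
    (hFt : composition_semigroup F Ft)
    (hPhi : generator Ft Phi) :
  cvg_compacts eventually (fun n z => Nat.iter (k n) (g n) z) F <->
  cvg_compacts eventually (fun n z => (RtoC (INR (k n)) * (g n z - z))%C) Phi.
Proof.
  assert (hk := eventually_INR_gt k hk_incr). split; intro H.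
  - apply (rescaled_cvg g k F Ft Phi); [|assumption..].
    split; try assumption. exact (proj1 hF).
  - now apply (euler_convergence g F k Ft Phi).
Qed.
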